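(* For all $n\ge1$ and all $\mu\in\mathbb{Z}^n$, the moment polytope $\mathrm{MP}(\overline{X_\mu})$ of the affine Schubert variety $\overline{X_\mu}\subset\mathrm{Gr}_n$ is a generalized permutahedron.
   Context: **Affine Schubert varieties.** $\mathrm{Gr}_n=\mathrm{GL}_n(\mathbb{C}((t)))/\mathrm{GL}_n(\mathbb{C}[[t]])$ is the affine Grassmannian (as an ind-variety). Let $\rho:\mathrm{GL}_n(\mathbb{C}[[t]])\to\mathrm{GL}_n(\mathbb{C})$ be the homomorphism $t\mapsto0$ and let $\mathrm{I}_n=\rho^{-1}(B_n^+(\mathbb{C}))$ be the Iwahori subgroup, where $B_n^+(\mathbb{C})$ is the group of invertible upper triangular matrices. For $\mu\in\mathbb{Z}^n$ let $t^\mu=\mathrm{diag}(t^{\mu_1},\dots,t^{\mu_n})$ and let $L_\mu=t^\mu\,\mathrm{GL}_n(\mathbb{C}[[t]])\in\mathrm{Gr}_n$ be the corresponding point. The open Schubert variety is the orbit $X_\mu=\mathrm{I}_n\cdot L_\mu$, and the affine Schubert variety $\overline{X_\mu}$ is its closure in $\mathrm{Gr}_n$. The points $L_\lambda$, $\lambda\in\mathbb{Z}^n$, are exactly the fixed points in $\mathrm{Gr}_n$ of the torus $T=(\mathbb{C}^* )^n$ of constant diagonal matrices. **Moment polytope.** $\mathrm{MP}(\overline{X_\mu})=\mathrm{conv}\{\lambda\in\mathbb{Z}^n: L_\lambda\in\overline{X_\mu}\}\subset\mathbb{R}^n$, the convex hull of the weights of the $T$-fixed points of $\overline{X_\mu}$.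 **Generalized permutahedron.** A polytope $P\subset\mathbb{R}^n$ is a generalized permutahedron if for every pair of adjacent vertices $\mathbf u,\mathbf v$ of $P$ there are $i,j\in[n]$ with $\mathbf u-\mathbf v\in\mathrm{span}(e_i-e_j)$. *)

(* Defs.v *)
From HB Require Import structures.
From mathcomp Require Import all_boot all_order all_algebra.
From mathcomp Require Import mpoly.
From mathcomp Require Import boolp classical_sets reals.
From mathcomp Require Import complex.

Set Implicit Arguments.
Unset Strict Implicit.
Unset Printing Implicit Defensive.

Import Order.TTheory GRing.Theory Num.Theory.
Local Open Scope ring_scope.
Local Open Scope classical_set_scope.

(* A record rather than [nat -> F]: the latter already carries the pointwise
   ring structure in MathComp-Analysis. *)
Record fps (F : Type) := Fps { fcoef : nat -> F }.

HB.instance Definition _ (F : Type) := gen_eqMixin (fps F).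
HB.instance Definition _ (F : Type) := gen_choiceMixin (fps F).

Lemma fpsP (F : Type) (f g : fps F) : fcoef f =1 fcoef g -> f = g.
Proof. by case: f => f; case: g => g /= /funext ->. Qed.

Section FpsRing.
Variable F : fieldType.
Implicit Types f g h : fps F.

Definition fps0 : fps F := Fps (fun=> 0).
Definition fps1 : fps F := Fps (fun i => (i == 0%N)%:R).
Definition fps_opp f : fps F := Fps (fun i => - fcoef f i).
Definition fps_add f g : fps F := Fps (fun i => fcoef f i + fcoef g i).
Definition fps_mul f g : fps F :=
  Fps (fun k => \sum_(i < k.+1) fcoef f i * fcoef g (k - i)).

Fact fps_addA : associative fps_add.
Proof. by move=> f g h; apply: fpsP => i /=; rewrite addrA. Qed.
Fact fps_addC : commutative fps_add.
Proof. by move=> f g; apply: fpsP => i /=; rewrite addrC. Qed.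
Fact fps_add0 : left_id fps0 fps_add.
Proof. by move=> f; apply: fpsP => i /=; rewrite add0r. Qed.
Fact fps_addN : left_inverse fps0 fps_opp fps_add.
Proof. by move=> f; apply: fpsP => i /=; rewrite addNr. Qed.

HB.instance Definition _ :=
  GRing.isZmodule.Build (fps F) fps_addA fps_addC fps_add0 fps_addN.

Let trunc N f : {poly F} := \poly_(i < N) fcoef f i.

Let mul_trunc N f g k : (k < N)%N ->
  fcoef (fps_mul f g) k = (trunc N f * trunc N g)`_k.
Proof.
move=> kN; rewrite coefM; apply: eq_bigr => i _; rewrite !coef_poly.
have iN : (i < N)%N by apply: leq_ltn_trans kN; rewrite -ltnS.
by rewrite iN (leq_ltn_trans (leq_subr i k) kN).
Qed.

Fact fps_mulC : commutative fps_mul.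
Proof.
by move=> f g; apply: fpsP => k; rewrite !(@mul_trunc k.+1) // mulrC.
Qed.

Let trunc_mul_coef N f g k : (k < N)%N ->
  (trunc N (fps_mul f g))`_k = (trunc N f * trunc N g)`_k.
Proof. by move=> kN; rewrite coef_poly kN; exact: mul_trunc. Qed.

Fact fps_mulA : associative fps_mul.
Proof.
move=> f g h; apply: fpsP => k; rewrite !(@mul_trunc k.+1) //.
transitivity ((trunc k.+1 f * (trunc k.+1 g * trunc k.+1 h))`_k).
  rewrite !coefM; apply: eq_bigr => i _.
  by rewrite trunc_mul_coef // ltnS leq_subr.
rewrite mulrA !coefM; apply: eq_bigr => i _.
by rewrite trunc_mul_coef.
Qed.

Fact fps_mul1 : left_id fps1 fps_mul.
Proof.
move=> f; apply: fpsP => k /=; rewrite big_ord_recl /= subn0 mul1r big1 ?addr0//.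
by move=> i _; rewrite mul0r.
Qed.
Fact fps_mulDl : left_distributive fps_mul fps_add.
Proof.
move=> f g h; apply: fpsP => k /=; rewrite -big_split /=.
by apply: eq_bigr => i _; rewrite mulrDl.
Qed.
Fact fps1_neq0 : fps1 != 0.
Proof.
apply/eqP => /(congr1 (fun f => fcoef f 0)) /= /eqP.
by rewrite oner_eq0.
Qed.

HB.instance Definition _ := GRing.Zmodule_isComNzRing.Build (fps F)
  fps_mulA fps_mulC fps_mul1 fps_mulDl fps1_neq0.

Definition fps_unit : pred (fps F) := fun f => fcoef f 0 != 0.

(* The first [k] coefficients of the inverse series, computed from
   [\sum_(j <= k) g_j f_(k - j) = (k == 0)]. *)
Fixpoint fps_inv_seq f (k : nat) : seq F :=
  if k is k'.+1 then
    let s := fps_inv_seq f k' in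
    rcons s ((fcoef f 0)^-1 *
             ((k' == 0%N)%:R - \sum_(j < k') s`_j * fcoef f (k' - j)))
  else [::].

Definition fps_inv f : fps F :=
  if fps_unit f then Fps (fun k => (fps_inv_seq f k.+1)`_k) else f.

Let size_inv_seq f k : size (fps_inv_seq f k) = k.
Proof. by elim: k => //= k IH; rewrite size_rcons IH. Qed.

Let nth_inv_seq f k j : (j < k)%N ->
  (fps_inv_seq f k)`_j = (fps_inv_seq f j.+1)`_j.
Proof.
elim: k => // k IH; rewrite ltnS leq_eqVlt => /orP[/eqP ->//|jk].
by rewrite [in LHS]/= nth_rcons size_inv_seq jk IH.
Qed.

Fact fps_mulV f : fps_unit f -> fps_inv f * f = 1.
Proof.
move=> uf; apply: fpsP => k; rewrite /fps_inv uf.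
rewrite [LHS]/= big_ord_recr /= subnn.
rewrite [in X in _ + X]nth_rcons size_inv_seq ltnn eqxx mulrAC mulVf // mul1r.
rewrite addrCA -[RHS]addr0; congr (_ + _); apply/eqP.
rewrite subr_eq0; apply/eqP/eq_bigr => j _.
by rewrite (nth_inv_seq f (ltn_ord j)).
Qed.

Fact fps_unitP f g : g * f = 1 -> fps_unit f.
Proof.
move=> /(congr1 (fun f => fcoef f 0)) /=; rewrite big_ord1 subn0 /fps_unit.
by move=> e; apply/eqP => f0; move: e => /eqP; rewrite f0 mulr0 eq_sym oner_eq0.
Qed.

Fact fps_inv_out : {in [predC fps_unit], fps_inv =1 id}.
Proof. by move=> f /negbTE nuf; rewrite /fps_inv ifF. Qed.

HB.instance Definition _ := GRing.ComNzRing_hasMulInverse.Build (fps F)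
  fps_mulV fps_unitP fps_inv_out.

Let low_coef f : f != 0 ->
  exists2 i, fcoef f i != 0 & forall j, (j < i)%N -> fcoef f j = 0.
Proof.
move=> f0; have exf : exists i, fcoef f i != 0.
  apply: contrapT => nex; move/eqP: f0; apply; apply: fpsP => i /=.
  by apply/eqP; apply/negPn/negP => fi; apply: nex; exists i.
case: (ex_minnP exf) => i fi imin; exists i => // j ji; apply/eqP.
by apply: contraTT ji => /imin; rewrite -leqNgt.
Qed.

Fact fps_integral f g : f * g = 0 -> (f == 0) || (g == 0).
Proof.
move=> fg0; apply/negPn; rewrite negb_or; apply/negP => /andP[].
move=> /low_coef[i fi flow] /low_coef[j gj glow].
move/(congr1 (fun h => fcoef h (i + j)%N)): fg0 => /=.
have iP : (i < (i + j).+1)%N by rewrite ltnS leq_addr.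
rewrite (bigD1 (Ordinal iP)) //= addKn big1 => [|k /eqP ki].
  by rewrite addr0 => /eqP; rewrite mulf_eq0 (negbTE fi) (negbTE gj).
have [lt_ki|lt_ik|eq_ki] := ltngtP k i; first by rewrite flow // mul0r.
  have kj : (i + j - k < j)%N.
    by rewrite ltn_subLR ?ltn_add2r // -ltnS.
  by rewrite (glow _ kj) mulr0.
by case: ki; apply: val_inj.
Qed.

HB.instance Definition _ :=
  GRing.ComUnitRing_isIntegral.Build (fps F) fps_integral.

Definition fpsX : fps F := Fps (fun i => (i == 1%N)%:R).

End FpsRing.

Notation laurent F := {fraction (fps F)}.

Section AffineGrassmannian.
Variables (F : fieldType) (n : nat).

Local Notation O := (fps F).
Local Notation K := (laurent F).
Local Notation oK := (map_mx (@FracField.tofrac O)).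

Definition tK : K := @FracField.tofrac O (fpsX F).

Definition gr_coset (g : 'M[K]_n) : set 'M[K]_n :=
  [set g *m oK a | a in [set a : 'M[O]_n | a \in unitmx]].

Definition affGr : set (set 'M[K]_n) :=
  [set gr_coset g | g in [set g : 'M[K]_n | g \in unitmx]].

(* The Zariski topology of the ind-variety.
    A coset [x = g GL_n(O)] is the same thing as the lattice [g O^n].
    [Gr_n] is the increasing union of the pieces [Gr^N] of lattices [L] with
    [t^N O^n <= L <= t^-N O^n]; such an [L] is determined by the subspace
    [L / t^N O^n] of [t^-N O^n / t^N O^n], a vector space with basis the
    [t^(j - N) e_i], [i < n], [j < 2N].  This embeds [Gr^N] as a closed
    subset of the disjoint union over [k] of the Grassmannians
    [Gr(k, F^(2Nn))], and a subset of [Gr_n] is closed iff its trace on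
    each [Gr^N] is closed, i.e. is cut out in [Gr^N] by homogeneous
    polynomials in the Pluecker coordinates. *)

Definition lattice_of (x : set 'M[K]_n) : set 'cV[K]_n :=
  [set v | exists2 g, x g & exists w : 'cV[O]_n, v = g *m oK w].

Definition std_lattice (d : int) : set 'cV[K]_n :=
  [set (tK ^ d) *: oK w | w in [set: 'cV[O]_n]].

Definition gr_piece (N : nat) : set (set 'M[K]_n) :=
  [set x | affGr x /\ std_lattice N%:Z `<=` lattice_of x
                   /\ lattice_of x `<=` std_lattice (- N%:Z)].

(* The image of [L] in [t^-N O^n / t^N O^n], in coordinates. *)
Definition lattice_image (N : nat) (L : set 'cV[K]_n) :
    set 'rV[F]_(n * (N + N)) :=
  [set mxvec (\matrix_(i < n, j < N + N) fcoef (w i 0) j)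
    | w in [set w : 'cV[O]_n | L (tK ^ (- N%:Z) *: oK w)]].

(* The maximal minors of [A], indexed by all maps from rows to columns: the
   minors at non-injective maps vanish and reordering the columns only changes
   the sign, so these are the Pluecker coordinates of the row space of [A] up
   to harmless repetitions. *)
Definition plucker (k m : nat) (A : 'M[F]_(k, m)) :
    'I_#|{ffun 'I_k -> 'I_m}| -> F :=
  fun s => \det (colsub (enum_val s : {ffun 'I_k -> 'I_m}) A).

Definition row_basis_of (k m : nat) (A : 'M[F]_(k, m)) (W : set 'rV[F]_m) :=
  row_free A /\ forall w, W w <-> (w <= A)%MS.

Definition gr_closed (Z : set (set 'M[K]_n)) : Prop :=
  Z `<=` affGr /\
  forall N k : nat,
    exists2 S : set {mpoly F[#|{ffun 'I_k -> 'I_(n * (N + N))}|]},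
      forall p, S p -> exists d : nat, p \is d.-homog
    & forall x (A : 'M[F]_(k, n * (N + N))), gr_piece N x ->
        row_basis_of A (@lattice_image N (lattice_of x)) ->
        (Z x <-> forall p, S p -> p.@[plucker A] = 0).

Definition gr_closure (X : set (set 'M[K]_n)) : set (set 'M[K]_n) :=
  smallest gr_closed X.

Definition rho (a : 'M[O]_n) : 'M[F]_n := map_mx (fun f => fcoef f 0) a.

(* [is_trig_mx] is lower triangularity. *)
Definition borel : set 'M[F]_n :=
  [set b | b \in unitmx /\ is_trig_mx b^T].

Definition iwahori : set 'M[O]_n :=
  [set a | a \in unitmx /\ borel (rho a)].

Definition tpow (mu : 'rV[int]_n) : 'M[K]_n :=
  diag_mx (\row_(i < n) tK ^ (mu 0 i)).

Definition Lpt (mu : 'rV[int]_n) : set 'M[K]_n := gr_coset (tpow mu).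

Definition schubert_cell (mu : 'rV[int]_n) : set (set 'M[K]_n) :=
  [set [set oK a *m g | g in Lpt mu] | a in iwahori].

Definition schubert_variety (mu : 'rV[int]_n) : set (set 'M[K]_n) :=
  gr_closure (schubert_cell mu).

End AffineGrassmannian.

Section Polytopes.
Variables (R : realType) (n : nat).
Implicit Types P X : set 'rV[R]_n.

Definition conv_hull X : set 'rV[R]_n :=
  [set x | exists k (c : 'I_k -> R) (p : 'I_k -> 'rV[R]_n),
    [/\ forall i, 0 <= c i, \sum_(i < k) c i = 1, forall i, X (p i)
      & x = \sum_(i < k) c i *: p i]].

Definition polytope P : Prop :=
  exists s : seq 'rV[R]_n, P = conv_hull [set x | x \in s].

Definition dot (c x : 'rV[R]_n) : R := \sum_(i < n) c 0 i * x 0 i.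

(* Nonempty faces of a polytope: the loci where a linear functional is
   maximal. *)
Definition face_of P (G : set 'rV[R]_n) : Prop :=
  exists c : 'rV[R]_n, G = [set x | P x /\ forall y, P y -> dot c y <= dot c x].

Definition vertex P (u : 'rV[R]_n) : Prop := face_of P [set u].

Definition adjacent P (u v : 'rV[R]_n) : Prop :=
  [/\ vertex P u, vertex P v, u != v & face_of P (conv_hull [set u; v])].

Definition generalized_permutahedron P : Prop :=
  polytope P /\
  forall u v, adjacent P u v ->
    exists (i j : 'I_n) (c : R), u - v = c *: (delta_mx 0 i - delta_mx 0 j).

End Polytopes.

Definition moment_polytope (R : realType) (n : nat)
    (Y : set (set 'M[laurent R[i]]_n)) : set 'rV[R]_n :=
  conv_hull [set map_mx intr l | l in [set l : 'rV[int]_n | Y (@Lpt R[i] n l)]].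

(* Main.v *)
(** Fix an order [h] of the coordinates.  By Hermite reduction every lattice is
    [g O^n] with [g] triangular for [h] with diagonal [t^l], and conjugating [g]
    by a one-parameter subgroup of the torus degenerates the lattice to [L_l].
    The sums of [l] over the initial segments of the coordinates are codimensions
    of projections of the lattice, hence semicontinuous.  As the Iwahori subgroup
    is open in an affine space, a generic point of the cell minimises all of them
    at once; so for each [h] there is a fixed point [L_l] of the Schubert variety
    whose prefix sums are minimal among all fixed points.  By Abel summation [l]
    then maximises every linear functional that increases along [h].  Thus the
    maximiser depends only on the order of the coefficients of the functional,
    which forces each edge to be parallel to some [e_i - e_j]. *)

Require Import Defs.
From HB Require Import structures.
From mathcomp Require Import all_boot all_order all_algebra.
From mathcomp Require Import mpoly.
From mathcomp Require Import boolp classical_sets reals.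
From mathcomp Require Import complex.
From mathcomp Require Import perm zify lra.

Set Implicit Arguments.
Unset Strict Implicit.
Unset Printing Implicit Defensive.

Import Order.TTheory GRing.Theory Num.Theory.
Local Open Scope ring_scope.

(** * Power series and their truncations *)

(** The closure is defined only as the smallest closed set, so it is approached from two sides. It
    lies in every closed set containing the cell, which calls for explicit Pluecker equations
    bounding prefix sums. It contains the limit of a curve in the cell, because the defining
    polynomials vanish along the curve and hence at its end. Both need explicit bases of the lattice
    images modulo [X ^+ (N + N)]. The Iwahori group preserves the standard lattices, so the whole
    cell lies in one piece and has bases with a common row set, linear in the group element. For a
    lattice triangular for [h], the largest number of columns below [u] in a nonzero minor gives the
    prefix sum at [u], and one minor attains this for all [u] at once. A nonzero minor stays nonzero
    generically, which yields the simultaneous minimum. *)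

Section PowerSeries.
Variable F : fieldType.
Implicit Types f g : fps F.

Local Notation X := (fpsX F).

Lemma fcoef0 k : fcoef (0 : fps F) k = 0.
Proof. by []. Qed.

Lemma fcoefD f g k : fcoef (f + g) k = fcoef f k + fcoef g k.
Proof. by []. Qed.

Lemma fcoefN f k : fcoef (- f) k = - fcoef f k.
Proof. by []. Qed.

Lemma fcoefM f g k :
  fcoef (f * g) k = \sum_(i < k.+1) fcoef f i * fcoef g (k - i).
Proof. by []. Qed.

Lemma fcoef_sum I (r : seq I) (P : pred I) (E : I -> fps F) k :
  fcoef (\sum_(i <- r | P i) E i) k = \sum_(i <- r | P i) fcoef (E i) k.
Proof. by apply: (big_morph (fun f => fcoef f k)). Qed.

Definition fpsC (c : F) : fps F := Fps (fun i => if i == 0%N then c else 0).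

Lemma fcoefCM c f k : fcoef (fpsC c * f) k = c * fcoef f k.
Proof.
rewrite fcoefM big_ord_recl /= subn0 big1 ?addr0 // => i _.
by rewrite mul0r.
Qed.

Lemma fpsC_is_zmod_morphism : zmod_morphism fpsC.
Proof.
by move=> a b; apply: fpsP => -[|k]; rewrite fcoefD fcoefN //= subr0.
Qed.

Lemma fpsC_is_monoid_morphism : monoid_morphism fpsC.
Proof.
split=> [|a b]; first by apply: fpsP => -[].
by apply: fpsP => k; rewrite fcoefCM; case: k => //= k; rewrite mulr0.
Qed.

HB.instance Definition _ :=
  GRing.isZmodMorphism.Build F (fps F) fpsC fpsC_is_zmod_morphism.
HB.instance Definition _ :=
  GRing.isMonoidMorphism.Build F (fps F) fpsC fpsC_is_monoid_morphism.

Definition constant_coef f : F := fcoef f 0.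

Lemma constant_coef_is_zmod_morphism : zmod_morphism constant_coef.
Proof. by []. Qed.

Lemma constant_coef_is_monoid_morphism : monoid_morphism constant_coef.
Proof. by split=> // f g; rewrite /constant_coef fcoefM big_ord1. Qed.

HB.instance Definition _ := GRing.isZmodMorphism.Build (fps F) F
  constant_coef constant_coef_is_zmod_morphism.
HB.instance Definition _ := GRing.isMonoidMorphism.Build (fps F) F
  constant_coef constant_coef_is_monoid_morphism.

Lemma fps_unitE f : (f \is a GRing.unit) = (fcoef f 0 != 0).
Proof. by []. Qed.

Lemma fcoefXnM d f k :
  fcoef (X ^+ d * f) k = if (k < d)%N then 0 else fcoef f (k - d).
Proof.
elim: d k => [|d IH] k; first by rewrite mul1r subn0.
rewrite exprS -mulrA fcoefM; case: k => [|k].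
  by rewrite big_ord1 /= mul0r.
rewrite !big_ord_recl !lift0 big1 => [|i _]; last by rewrite /= mul0r.
by rewrite /= mul0r add0r mul1r addr0 !subSS subn0 -fcoefM IH.
Qed.

Lemma fpsX_neq0 : X != 0.
Proof.
by apply/eqP => /(congr1 (fun f => fcoef f 1)) /eqP; rewrite oner_eq0.
Qed.

Lemma fpsXn_neq0 d : X ^+ d != 0.
Proof. by rewrite expf_neq0 // fpsX_neq0. Qed.

Lemma fpsXn_dvd d f :
  (forall k, (k < d)%N -> fcoef f k = 0) -> exists g, f = X ^+ d * g.
Proof.
move=> f0; exists (Fps (fun k => fcoef f (k + d))).
apply: fpsP => k; rewrite fcoefXnM; case: ltnP => [/f0 //|dk] /=.
by rewrite subnK.
Qed.

Lemma fps_factor f : f != 0 ->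
  exists d g, g \is a GRing.unit /\ f = X ^+ d * g.
Proof.
move=> f0; have exf : exists i, fcoef f i != 0.
  apply: contrapT => nex; move/eqP: f0; apply; apply: fpsP => i /=.
  by apply/eqP; apply/negPn/negP => fi; apply: nex; exists i.
case: (ex_minnP exf) => d fd dmin.
have [k kd|g fE] := @fpsXn_dvd d f.
  by apply/eqP; apply: contraTT kd => /dmin; rewrite -leqNgt.
exists d, g; split=> //; move: fd.
by rewrite fE fcoefXnM ltnn subnn fps_unitE.
Qed.

Lemma leq_fpsXn_dvd d e f : X ^+ e = X ^+ d * f -> (d <= e)%N.
Proof.
move=> /(congr1 (fun f => fcoef f e)); rewrite fcoefXnM leqNgt.
rewrite -[X ^+ e]mulr1 fcoefXnM ltnn subnn; case: ltnP => // _ /eqP.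
by rewrite oner_eq0.
Qed.

End PowerSeries.

(** * The quotient O^n / X^m O^n in coordinates *)

Section Jets.
Variables (F : fieldType) (n m : nat).

Local Notation O := (fps F).
Local Notation X := (fpsX F).

Definition cell_of (c : 'I_(n * m)) : 'I_n * 'I_m :=
  enum_val (cast_ord (esym (mxvec_cast n m)) c).

Lemma cell_ofK i j : cell_of (mxvec_index i j) = (i, j).
Proof. by rewrite /cell_of cast_ordK enum_rankK. Qed.

Lemma cell_of_inj : injective cell_of.
Proof. by move=> c c' /enum_val_inj /cast_ord_inj. Qed.

Definition jet (w : 'cV[O]_n) : 'rV[F]_(n * m) :=
  \row_c fcoef (w (cell_of c).1 0) (cell_of c).2.

Lemma jetE w c : jet w 0 c = fcoef (w (cell_of c).1 0) (cell_of c).2.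
Proof. by rewrite mxE. Qed.

Lemma mxvec_jet (w : 'cV[O]_n) :
  mxvec (\matrix_(i < n, j < m) fcoef (w i 0) j) = jet w.
Proof.
by apply/rowP; case/mxvec_indexP => i j; rewrite mxvecE jetE cell_ofK mxE.
Qed.

Lemma jetD v w : jet (v + w) = jet v + jet w.
Proof. by apply/rowP => c; rewrite !mxE fcoefD. Qed.

Lemma jetB v w : jet (v - w) = jet v - jet w.
Proof. by apply/rowP => c; rewrite !mxE fcoefD. Qed.

Lemma jet0 : jet 0 = 0.
Proof. by apply/rowP => c; rewrite !mxE. Qed.

Lemma jetZ a w : jet (fpsC a *: w) = a *: jet w.
Proof. by apply/rowP => c; rewrite !mxE fcoefCM. Qed.

Lemma jet_sum I (r : seq I) (P : pred I) (E : I -> 'cV[O]_n) :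
  jet (\sum_(i <- r | P i) E i) = \sum_(i <- r | P i) jet (E i).
Proof. exact: (big_morph _ jetD jet0). Qed.

(** The polynomial representative: coefficients of index at least [m] take the default 0. *)
Definition unjet (x : 'rV[F]_(n * m)) : 'cV[O]_n :=
  \col_i Fps (fun q => oapp (vec_mx x i) 0 (insub q)).

Lemma unjetK x : jet (unjet x) = x.
Proof.
apply/rowP; case/mxvec_indexP => i j.
by rewrite jetE cell_ofK !mxE /= valK /= mxE.
Qed.

Lemma jet_eq0 w : jet w = 0 <-> exists y, w = X ^+ m *: y.
Proof.
split=> [w0|[y ->]]; last first.
  by apply/rowP => c; rewrite jetE !mxE fcoefXnM ltn_ord.
have wP i : exists y, w i 0 = X ^+ m * y.
  apply: fpsXn_dvd => k km.
  have /rowP/(_ (mxvec_index i (Ordinal km))) := w0.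
  by rewrite jetE cell_ofK mxE.
have [y yP] := choice wP; exists (\col_i y i).
by apply/colP => i; rewrite !mxE -yP.
Qed.

Lemma jet_eq v w : jet v = jet w <-> exists y, v = w + X ^+ m *: y.
Proof.
split=> [e|[y ->]].
  have /jet_eq0[y yP] : jet (v - w) = 0 by rewrite jetB e subrr.
  by exists y; rewrite -yP addrC subrK.
have /jet_eq0 e : exists z, X ^+ m *: y = X ^+ m *: z by exists y.
by rewrite jetD e addr0.
Qed.

(** The kernel X^m O^n of [jet] is stable under matrices over O, so [b] acts on the quotient. *)
Lemma jet_mul (b : 'M[O]_n) v w :
  jet v = jet w -> jet (b *m v) = jet (b *m w).
Proof.
move=> /jet_eq[y ->]; apply/jet_eq; exists (b *m y).
by rewrite mulmxDr scalemxAr.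
Qed.

(* Only meaningful on the cells [(j, q)] with [d j <= q], the subtraction being
   truncated. *)
Definition cell_vec (b : 'M[O]_n) (d : 'I_n -> nat) (c : 'I_(n * m)) :
    'cV[O]_n :=
  X ^+ ((cell_of c).2 - d (cell_of c).1) *: col (cell_of c).1 b.

(** The action of [b] on the quotient: row (j, q) is the image of the monomial X^q e_j. *)
Definition full_mx (b : 'M[O]_n) : 'M[F]_(n * m) :=
  \matrix_c jet (cell_vec b (fun=> 0%N) c).

Lemma jet_full_mx b w : jet w *m full_mx b = jet (b *m w).
Proof.
(* A polynomial representative is a finite sum of monomials, which [w] need not be. *)
rewrite -[in RHS](@jet_mul b _ _ (unjetK (jet w))).
set x := jet w.
have -> : unjet x = \sum_c fpsC (x 0 c) *:
    (X ^+ (cell_of c).2 *: delta_mx (cell_of c).1 0).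
  apply/colP => i; apply: fpsP => q; rewrite mxE summxE fcoef_sum /=.
  rewrite (eq_bigr (fun c => x 0 c * ((cell_of c).1 == i)%:R *
     (q == (cell_of c).2 :> nat)%:R)); last first.
    move=> c _; rewrite !mxE eqxx andbT fcoefCM -mulrA; congr (_ * _).
    rewrite eq_sym fcoefXnM; case: (_ == _) => /=; last first.
      by rewrite mul0r; case: ifP.
    rewrite mul1r; case: ltngtP => // h; last by rewrite -h subnn.
    by rewrite subn_eq0 leqNgt h.
  case: insubP => [j jm jq|qm] /=; last first.
    rewrite big1 // => c _.
    have [e|_] := eqVneq q (cell_of c).2; last by rewrite mulr0.
    by rewrite e ltn_ord in qm.
  rewrite mxE (bigD1 (mxvec_index i j)) //= cell_ofK /= eqxx -jq eqxx !mulr1.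
  rewrite big1 ?addr0 //; case/mxvec_indexP => i' j'; rewrite cell_ofK /=.
  move=> ne; have [ei|_] := eqVneq i' i; last by rewrite mulr0 mul0r.
  case: eqP => [ej|_]; last by rewrite mulr0.
  by rewrite ei (val_inj ej) eqxx in ne.
rewrite mulmx_sumr jet_sum mulmx_sum_row; apply: eq_bigr => c _.
rewrite rowK -jetZ /cell_vec subn0; congr jet.
by rewrite -!scalemxAr -colE.
Qed.

Lemma full_mx_unit (a : 'M[O]_n) : a \in unitmx -> full_mx a \in unitmx.
Proof.
move=> ua; have full_mxV : full_mx a *m full_mx (invmx a) = 1%:M.
  apply/row_matrixP => c; rewrite !rowE mulmxA mulmx1.
  by rewrite -[delta_mx 0 c]unjetK !jet_full_mx mulKmx.
by have [-> _] := mulmx1_unit full_mxV.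
Qed.

(** For [b] triangular with diagonal X^d, these index the leading monomials X^q e_j of elements of b
    O^n. *)
Definition cells (d : 'I_n -> nat) : {set 'I_(n * m)} :=
  [set c | d (cell_of c).1 <= (cell_of c).2]%N.

Definition cell_mx (b : 'M[O]_n) (d : 'I_n -> nat) :
    'M[F]_(#|cells d|, n * m) :=
  \matrix_r jet (cell_vec b d (enum_val r)).

End Jets.

(** * Pluecker coordinates of triangular lattices *)

Lemma count_leq_iota e p : count (fun j => e <= j)%N (iota 0 p) = (p - e)%N.
Proof.
elim: p => // p IH; rewrite -addn1 iotaD count_cat IH /= add0n addn0.
by case: leqP; lia.
Qed.

Section LinearAlgebra.
Variable F : fieldType.

(** A row vector in the kernel vanishes coordinate by coordinate, in order of increasing [key]. *)
Lemma unitmx_unitriangular k (key : 'I_k -> nat) (A : 'M[F]_k) :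
    (forall r, A r r = 1) ->
    (forall r c, r != c -> A r c != 0 -> (key r < key c)%N) ->
  A \in unitmx.
Proof.
move=> A1 Alt; rewrite -row_free_unit; apply: inj_row_free => v vA0.
apply/rowP => r; rewrite [RHS]mxE; move: {2}(key r) (leqnn (key r)) => p.
elim: p r => [|p IH] r rp; have /rowP/(_ r) := vA0; rewrite !mxE.
  rewrite (bigD1 r) //= A1 mulr1 big1 ?addr0 // => c /Alt/contraNeq Ac.
  by rewrite Ac ?mulr0 // -leqNgt (leq_trans rp).
rewrite (bigD1 r) //= A1 mulr1 big1 ?addr0 // => c /Alt/contraNeq Ac.
have [cr|rc] := ltnP (key c) (key r); last by rewrite Ac ?mulr0 // -leqNgt.
by rewrite IH ?mul0r // -ltnS (leq_trans cr).
Qed.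

(** The columns in [Q] are supported on the rows in [P]; if [Q] is larger, every term of the Leibniz
    expansion meets a zero entry. *)
Lemma det_neq0_card k (P Q : pred 'I_k) (A : 'M[F]_k) :
    (forall r c, ~~ P r -> Q c -> A r c = 0) ->
  \det A != 0 -> (#|Q| <= #|P|)%N.
Proof.
move=> A0; apply: contra_neqT; rewrite -ltnNge => ltPQ.
rewrite /determinant big1 // => s _.
have [/forallP sP|/forallPn[r]] := boolP [forall r : 'I_k, Q (s r) ==> P r].
  move: ltPQ; rewrite ltnNge => /negP[].
  rewrite -(card_image (@perm_inj _ s^-1%g) Q).
  apply: subset_leq_card. apply/fintype.subsetP => r /fintype.imageP[c Qc ->].
  by apply: (implyP (sP _)); rewrite permKV.
rewrite negb_imply => /andP[Qr Pr].
by rewrite (bigD1 r) //= A0 // mul0r mulr0.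
Qed.

Lemma row_free_rowsub k N (f : 'I_k -> 'I_N) (A : 'M[F]_N) :
  injective f -> A \in unitmx -> row_free (rowsub f A).
Proof.
move=> fI Au; apply: inj_row_free => v.
rewrite rowsubE mulmxA => /(congr1 (mulmx^~ (invmx A))).
rewrite mulmxK // mul0mx => /rowP e; apply/rowP => r.
have := e (f r); rewrite !mxE (bigD1 r) //= !mxE eqxx mulr1 big1 ?addr0 //.
by move=> c cr; rewrite !mxE (inj_eq fI) (negbTE cr) mulr0.
Qed.

Lemma supported_mulmx_sub N p (D : {set 'I_N}) (x : 'rV[F]_N) (A : 'M_(N, p)) :
    (forall c, c \notin D -> x 0 c = 0) ->
  (x *m A <= rowsub (fun r : 'I_#|D| => enum_val r) A)%MS.
Proof.
move=> xD; rewrite mulmx_sum_row; apply: summx_sub => c _.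
have [cD|/xD ->] := boolP (c \in D); last by rewrite scale0r sub0mx.
apply: scalemx_sub; rewrite -(enum_rankK_in cD cD).
by rewrite -row_rowsub row_sub.
Qed.

Lemma row_basis_size k k' N (A : 'M[F]_(k, N)) (B : 'M_(k', N)) W :
  row_basis_of A W -> row_basis_of B W -> k = k'.
Proof.
move=> [/eqP fA AW] [/eqP fB BW]; apply/eqP; rewrite -fA -fB eqn_leq.
by apply/andP; split; apply: mxrankS; apply/row_subP => i;
  [apply/BW/AW | apply/AW/BW]; apply: row_sub.
Qed.

Lemma row_basis_change k N (A B : 'M[F]_(k, N)) W :
    row_basis_of A W -> row_basis_of B W ->
  exists2 U, U \in unitmx & A = U *m B.
Proof.
move=> [/eqP fA AW] [fB BW].
have /submxP[U AU] : (A <= B)%MS.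
  by apply/row_subP => i; apply/BW/AW/row_sub.
exists U => //; rewrite -row_free_unit /row_free eqn_leq rank_leq_row.
by rewrite -[X in (X <= _)%N]fA AU mxrankM_maxl.
Qed.

Lemma det_colsub_mul k N (U : 'M[F]_k) (A : 'M_(k, N)) (J : 'I_k -> 'I_N) :
  \det (colsub J (U *m A)) = \det U * \det (colsub J A).
Proof.
rewrite -det_mulmx; congr (\det _); apply/matrixP => i j.
by rewrite !mxE; apply: eq_bigr => l _; rewrite !mxE.
Qed.

End LinearAlgebra.

Local Open Scope classical_set_scope.

Section CellBases.
Variables (F : fieldType) (n m : nat).

Local Notation O := (fps F).
Local Notation X := (fpsX F).

Definition jet_image (b : 'M[O]_n) : set 'rV[F]_(n * m) :=
  [set y | exists v, y = jet m (b *m v)].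

Lemma sub_cell_mx b d y : (y <= cell_mx m b d)%MS -> jet_image b y.
Proof.
move=> /submxP[x ->].
exists (\sum_r fpsC (x 0 r) *: (X ^+ ((cell_of (enum_val r)).2
         - d (cell_of (enum_val r)).1) *: delta_mx (cell_of (enum_val r)).1 0)).
rewrite mulmx_sumr jet_sum mulmx_sum_row; apply: eq_bigr => r _.
by rewrite rowK -jetZ -!scalemxAr -colE.
Qed.

(** This makes minors polynomial in [s] along a pencil of lattices. *)
Lemma cell_mx_linear (b b' : 'M[O]_n) d s :
  cell_mx m (b + fpsC s *: b') d = cell_mx m b d + s *: cell_mx m b' d.
Proof.
apply/matrixP => r c; rewrite !mxE mulrDr mulrCA fcoefD fcoefCM.
exact: erefl.
Qed.

Definition diagX (d : 'I_n -> nat) : 'M[O]_n := diag_mx (\row_i X ^+ d i).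

(** The factor X^(d j) of column j cancels the shift in [cell_vec], so the rows are those of the
    invertible [full_mx m a] at [cells m d]. *)
Lemma cell_mx_unit_basis (a : 'M[O]_n) d : a \in unitmx ->
  row_basis_of (cell_mx m (a *m diagX d) d) (jet_image (a *m diagX d)).
Proof.
move=> ua; have cE : cell_mx m (a *m diagX d) d =
    rowsub (fun r : 'I_#|cells m d| => enum_val r) (full_mx m a).
  apply/row_matrixP => r; rewrite row_rowsub !rowK; congr jet.
  have := enum_valP r; rewrite inE /cell_vec subn0; move: (cell_of _) => [i q].
  move=> /= dq; apply/colP => j; rewrite !mxE (bigD1 i) //= !mxE eqxx big1.
    by rewrite addr0 mulr1n mulrCA -exprD subnK // mulrC.
  by move=> l li; rewrite !mxE (negbTE li) mulr0.
split.
  by rewrite cE; apply: row_free_rowsub enum_val_inj (full_mx_unit m ua).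
move=> y; split; last exact: sub_cell_mx.
case=> v ->; rewrite -mulmxA cE -jet_full_mx; apply: supported_mulmx_sub => c.
rewrite inE -ltnNge jetE mul_diag_mx !mxE => cd.
by rewrite fcoefXnM cd.
Qed.

(** With m = 2N this is the lower bound defining the [N]-th piece, after scaling by t^N. *)
Definition contains_Xn (b : 'M[O]_n) :=
  forall v : 'cV[O]_n, exists w, X ^+ m *: v = b *m w.

Lemma contains_Xn_det_neq0 b : contains_Xn b -> \det b != 0.
Proof.
move=> bb; have [c cP] := choice (fun j => bb (delta_mx j 0)).
pose C : 'M[O]_n := \matrix_(i, j) c j i 0.
have colC j : col j C = c j by apply/colP => i; rewrite !mxE.
have bC : b *m C = (X ^+ m)%:M.
  apply/matrixP => i j; have /colP/(_ i) := cP j.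
  rewrite -colC colE mulmxA -colE !mxE => <-.
  by rewrite eqxx andbT mulr_natr.
apply: contraTneq isT => db; have := congr1 determinant bC.
rewrite det_mulmx db mul0r det_scalar => /esym/eqP.
by rewrite expf_eq0 (negbTE (fpsXn_neq0 F m)) andbF.
Qed.

Variables (h : 'I_n -> nat) (h_inj : injective h).

Definition triangular (b : 'M[O]_n) (d : 'I_n -> nat) :=
  (forall i j, (h i < h j)%N -> b i j = 0) /\ (forall i, b i i = X ^+ d i).

Variables (b : 'M[O]_n) (d : 'I_n -> nat).
Hypothesis b_tri : triangular b d.
Hypothesis b_big : contains_Xn b.

(** Take for [j] the first nonzero coordinate of [v] in the order of [h]. *)
Lemma triangular_lead (v : 'cV[O]_n) : v != 0 -> exists j,
  v j 0 != 0 /\ (b *m v) j 0 = X ^+ d j * v j 0.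
Proof.
move=> /matrix0Pn[i [z vi]]; rewrite (ord1 z) in vi.
case: (arg_minnP (P := fun j => v j 0 != 0) h vi) => j vj jmin.
exists j; split=> //; rewrite mxE (bigD1 j) //= big1 => [|l lj].
  by rewrite addr0 b_tri.2.
have [vl0|/jmin hl] := eqVneq (v l 0) 0; first by rewrite vl0 mulr0.
rewrite b_tri.1 ?mul0r // ltn_neqAle hl andbT.
by apply: contra_neq lj => /h_inj.
Qed.

Lemma triangular_exp_leq i : (d i <= m)%N.
Proof.
have [w wE] := b_big (delta_mx i 0).
have w0 : w != 0.
  apply: contraTneq isT => w0; move: wE; rewrite w0 mulmx0.
  move/colP/(_ i); rewrite !mxE !eqxx mulr1 => /eqP.
  by rewrite (negbTE (fpsXn_neq0 F m)).
have [j [wj]] := triangular_lead w0; rewrite -wE !mxE eqxx andbT.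
have [->|ji] := eqVneq j i; first by rewrite mulr1 => /leq_fpsXn_dvd.
by move/esym/eqP; rewrite mulr0 mulf_eq0 (negbTE wj) (negbTE (fpsXn_neq0 _ _)).
Qed.

Lemma cell_vecE i (c : 'I_(n * m)) : cell_vec b d c i 0 =
  X ^+ ((cell_of c).2 - d (cell_of c).1) * b i (cell_of c).1.
Proof. by rewrite !mxE. Qed.

(* A unitriangular completion of [cell_mx b d]. *)
Let T : 'M[F]_(n * m) := \matrix_c
  (if c \in cells m d then jet m (cell_vec b d c) else delta_mx 0 c).

(** The lexicographic order on (h j, q), since q < m. *)
Let key (c : 'I_(n * m)) := (h (cell_of c).1 * m + (cell_of c).2)%N.

Let T_diag c : T c c = 1.
Proof.
rewrite mxE; case: ifP => [|_]; last by rewrite mxE !eqxx.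
rewrite inE jetE cell_vecE => dc.
by rewrite b_tri.2 -exprD subnK // -[_ ^+ _]mulr1 fcoefXnM ltnn subnn.
Qed.

Let T_key r c : r != c -> T r c != 0 -> (key r < key c)%N.
Proof.
move=> rc; rewrite mxE; case: ifP => [|_]; last first.
  by rewrite mxE eqxx /= [c == r]eq_sym (negbTE rc) eqxx.
rewrite inE jetE cell_vecE => dr; rewrite /key.
have [hlt|hle] := ltnP (h (cell_of c).1) (h (cell_of r).1).
  by rewrite b_tri.1 // mulr0 eqxx.
have := ltn_ord (cell_of r).2 => rm.
move: hle; rewrite leq_eqVlt => /orP[/eqP hE|hlt _]; last first.
  apply: leq_trans (leq_addr _ _); rewrite -ltn_subRL -mulnBl.
  by rewrite (leq_trans rm) // leq_pmull // subn_gt0.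
move/h_inj: hE => cE; rewrite -cE b_tri.2 -exprD subnK // ltn_add2l.
rewrite -[_ ^+ _]mulr1 fcoefXnM; case: ltnP => [|qq _]; first by rewrite eqxx.
rewrite ltn_neqAle qq andbT; apply: contra_neq rc => e.
apply: cell_of_inj; move: cE e; move: (cell_of r) (cell_of c).
by move=> [? ?] [? ?] /= -> /val_inj ->.
Qed.

Let T_unit : T \in unitmx.
Proof. exact: unitmx_unitriangular T_diag T_key. Qed.

Let cell_mxE : cell_mx m b d =
  rowsub (fun r : 'I_#|cells m d| => enum_val r) T.
Proof.
apply/row_matrixP => r; rewrite row_rowsub !rowK.
by rewrite (enum_valP r).
Qed.

(** Expand a lattice element in the rows of [T] and subtract the part on [cells m d]. The rest
    [xout] is supported off these cells and, since X^m O^n lies in the lattice, [unjet xout] is some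
    b w. If w were nonzero, its leading entry would give a nonzero coefficient of [unjet xout] in
    coordinate j and degree at least d j, hence on one of the cells. *)
Lemma cell_mx_triangular_basis :
  row_basis_of (cell_mx m b d) (jet_image b).
Proof.
split; first by rewrite cell_mxE; apply: row_free_rowsub enum_val_inj T_unit.
move=> y; split; last exact: sub_cell_mx.
case=> v ->; set x := jet m (b *m v) *m invmx T.
have xT : jet m (b *m v) = x *m T by rewrite mulmxKV.
rewrite xT cell_mxE; apply: supported_mulmx_sub.
pose xin : 'rV[F]_(n * m) := \row_c (if c \in cells m d then x 0 c else 0).
pose xout : 'rV[F]_(n * m) := \row_c (if c \in cells m d then 0 else x 0 c).
have xE : x = xin + xout.
  by apply/rowP => c; rewrite !mxE; case: ifP; rewrite ?addr0 ?add0r.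
have [v1 v1E] : jet_image b (xin *m T).
  apply: (@sub_cell_mx _ d); rewrite cell_mxE; apply: supported_mulmx_sub => c.
  by rewrite mxE => /negbTE ->.
have outT : xout *m T = xout.
  rewrite mulmx_sum_row; apply/rowP => c; rewrite summxE.
  rewrite (bigD1 c) //= big1 => [|l lc]; rewrite !mxE; case: ifP => cD.
  - by rewrite mul0r addr0.
  - by rewrite mxE !eqxx mulr1 addr0.
  - by rewrite mul0r.
  - by rewrite mxE eqxx /= [c == l]eq_sym (negbTE lc) mulr0.
have [z zE] : exists z, b *m (v - v1) = unjet xout + X ^+ m *: z.
  apply/jet_eq; rewrite unjetK mulmxBr jetB xT -v1E xE mulmxDl outT.
  by rewrite addrC addKr.
have [w wE] := b_big z.
have outE : unjet xout = b *m (v - v1 - w).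
  by rewrite mulmxBr zE -wE addrK.
suff out0 : v - v1 - w = 0.
  move=> c cD; have /rowP/(_ c) : xout = 0.
    by rewrite -[xout]unjetK outE out0 mulmx0 jet0.
  by rewrite !mxE (negbTE cD).
apply/eqP/contraT => /triangular_lead[j [vj]]; rewrite -outE.
rewrite mxE => e; case/eqP: vj; apply: fpsP => q.
have := congr1 (fun f => fcoef f (q + d j)%N) e; rewrite fcoefXnM.
rewrite ltnNge leq_addl addnK /= => <-.
case: insubP => //= l lm lE; rewrite !mxE inE cell_ofK /= lE.
by rewrite leq_addl.
Qed.

Lemma card_cells_below u :
  #|[set c in cells m d | (h (cell_of c).1 < u)%N]| =
  (\sum_(i < n | (h i < u)%N) (m - d i))%N.
Proof.
rewrite -sum1_card (reindex (uncurry (@mxvec_index n m))) /=; last first.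
  by apply: subon_bij (curry_mxvec_bij n m).
rewrite (eq_bigl (fun p : 'I_n * 'I_m => (h p.1 < u) && (d p.1 <= p.2))%N).
  rewrite -(pair_big_dep (fun i => h i < u)%N (fun i (j : 'I_m) => d i <= j)%N
    (fun=> fun=> 1%N)) /=.
  apply: eq_bigr => i _; rewrite -(big_mkord (fun j => d i <= j)%N (fun=> 1%N)).
  by rewrite sum1_count /index_iota subn0 count_leq_iota.
by case=> i j; rewrite !inE /= cell_ofK andbC.
Qed.

Definition count_below k (J : 'I_k -> 'I_(n * m)) (u : nat) : nat :=
  #|[pred r | h (cell_of (J r)).1 < u]%N|.

Let count_enum (P : pred 'I_(n * m)) :
  #|[pred r : 'I_#|cells m d| | P (enum_val r)]| = #|[set c in cells m d | P c]|.
Proof.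
rewrite -(card_imset _ enum_val_inj); apply: eq_card => c; rewrite !inE.
apply/imsetP/andP => [[r Pr ->]|[cD Pc]].
  by split=> //; have := enum_valP r; rewrite inE.
have cD' : c \in cells m d by rewrite inE.
exists (enum_rank_in cD' c); last by rewrite enum_rankK_in.
by rewrite inE enum_rankK_in.
Qed.

(** By triangularity the rows of cells not below [u] vanish on columns below [u], so [det_neq0_card]
    gives the bound. The pivot columns [cells m d] form a unitriangular minor that attains it for
    every [u]. *)
Lemma triangular_minors k (A : 'M[F]_(k, n * m)) :
    row_basis_of A (jet_image b) ->
  (forall J : 'I_k -> 'I_(n * m), \det (colsub J A) != 0 -> forall u,
     (count_below J u <= \sum_(i < n | (h i < u)%N) (m - d i))%N) /\
  (exists2 J : 'I_k -> 'I_(n * m), \det (colsub J A) != 0 &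
     forall u, count_below J u = (\sum_(i < n | (h i < u)%N) (m - d i))%N).
Proof.
move=> Ab; have Bb := cell_mx_triangular_basis.
have e := row_basis_size Ab Bb; subst k.
have [U Uu ->] := row_basis_change Ab Bb.
have Ud : \det U != 0 by rewrite -unitfE -unitmxE.
split=> [J|].
  rewrite det_colsub_mul mulf_eq0 negb_or => /andP[_ dJ] u.
  rewrite -card_cells_below -count_enum.
  apply: det_neq0_card dJ => r c; rewrite !inE -leqNgt !mxE.
  by move=> ur cu; rewrite b_tri.1 ?mulr0 ?fcoef0 // (leq_trans cu).
exists (fun r => enum_val r).
  rewrite det_colsub_mul mulf_neq0 // -unitfE -unitmxE.
  pose kk (r : 'I_#|cells m d|) := key (enum_val r).
  apply: (@unitmx_unitriangular _ _ kk) => [r|r c rc].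
    by rewrite cell_mxE !mxE /= -[RHS](T_diag (enum_val r)) !mxE.
  move=> Tn0; apply: T_key; first by rewrite (inj_eq enum_val_inj).
  by move: Tn0; rewrite cell_mxE !mxE.
by move=> u; rewrite -card_cells_below -count_enum.
Qed.

End CellBases.

(** * Hermite reduction over power series *)

Section Hermite.
Variables (F : fieldType) (n m : nat) (h : 'I_n -> nat).
Hypothesis h_inj : injective h.

Local Notation O := (fps F).
Local Notation X := (fpsX F).

(** Column j is a lattice vector vanishing in all coordinates before j, of least valuation in
    coordinate j and normalised there to a power of X. Minimality makes it divide the j-th entry of
    every competitor, so these columns span the lattice by elimination. *)
Lemma hermite_form (b : 'M[O]_n) : contains_Xn m b ->
  exists u d, u \in unitmx /\ triangular h (b *m u) d.
Proof.
move=> b_big.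
pose low j (v : 'cV[O]_n) := forall i, (h i < h j)%N -> v i 0 = 0.
have minP j : exists p : nat * 'cV[O]_n,
    [/\ low j (b *m p.2), (b *m p.2) j 0 = X ^+ p.1
      & forall v, low j (b *m v) -> exists f, (b *m v) j 0 = X ^+ p.1 * f].
  pose P e := `[< exists v, low j (b *m v) /\
                   exists2 f, f \is a GRing.unit & (b *m v) j 0 = X ^+ e * f >].
  have exP : exists e, P e.
    have [v vE] := b_big (delta_mx j 0); exists m; apply/asboolP; exists v.
    rewrite -vE; split=> [i|]; last by exists 1; rewrite ?unitr1 // !mxE !eqxx.
    rewrite !mxE andbT; case: eqP => [->|_]; first by rewrite ltnn.
    by rewrite mulr0.
  case: (ex_minnP exP) => e /asboolP[v [vlow [f fu vj]]] emin.
  exists (e, f^-1 *: v); rewrite -scalemxAr; split=> [i ij||w wlow] /=.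
  - by rewrite mxE vlow // mulr0.
  - by rewrite mxE vj mulrCA mulVr // mulr1.
  have [->|/fps_factor[e' [g [gu wE]]]] := eqVneq ((b *m w) j 0) 0.
    by exists 0; rewrite mulr0.
  exists (X ^+ (e' - e) * g); rewrite mulrA -exprD subnKC ?wE //.
  by apply/emin/asboolP; exists w; split=> //; exists g.
have [p pP] := choice minP.
pose u : 'M[O]_n := \matrix_(i, j) (p j).2 i 0.
have colu j : col j (b *m u) = b *m (p j).2.
  rewrite colE -mulmxA -colE; congr (_ *m _).
  by apply/colP => i; rewrite !mxE.
have buE i j : (b *m u) i j = (b *m (p j).2) i 0.
  by rewrite -colu [RHS]mxE. 
exists u, (fun j => (p j).1); split; last first.
  split=> [i j ij|i]; rewrite buE; last by have [] := pP i.
  by have [jlow _ _] := pP j; apply: jlow.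
(* Only the last [q] levels of [h] may carry nonzero entries; the first of these is eliminated at
   each step. *)
have span q (v : 'cV[O]_n) :
    (forall i, (h i + q < (\max_i h i).+1)%N -> (b *m v) i 0 = 0) ->
    exists w, b *m v = b *m u *m w.
  elim: q v => [|q IH] v v0.
    exists 0; rewrite mulmx0; apply/colP => i; rewrite v0 ?mxE //.
    by rewrite addn0 ltnS leq_bigmax.
  (* Being merely injective, [h] may skip this level; then nothing has to be eliminated. *)
  have [j /eqP jq|nj] := pickP (fun j => h j + q == \max_i h i)%N; last first.
    apply: IH => i; rewrite ltnS leq_eqVlt nj /= => lt_i; apply: v0.
    by rewrite addnS ltnS.
  have [blow bj bdiv] := pP j.
  have [|f fE] := bdiv v.
    by move=> i ij; rewrite v0 // addnS ltnS -jq ltn_add2r.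
  have [|w wE] := IH (v - f *: (p j).2).
    move=> i; rewrite ltnS leq_eqVlt mulmxBr -scalemxAr !mxE => /orP[/eqP iq|iq].
      have -> : i = j by apply: h_inj; apply/eqP; rewrite -(eqn_add2r q) iq jq.
      by rewrite !mxE in bj fE; rewrite fE bj mulrC subrr.
    have := v0 i; rewrite mxE => -> //; last by rewrite addnS ltnS.
    have := blow i; rewrite mxE => ->; first by rewrite mulr0 subr0.
    by move: iq; rewrite -jq ltn_add2r.
  exists (w + f *: delta_mx j 0); rewrite mulmxDr -wE -scalemxAr -colE colu.
  by rewrite mulmxBr -scalemxAr subrK.
have {}span (v : 'cV[O]_n) : exists w, b *m v = b *m u *m w.
  apply: (span (\max_i h i).+1) => i.
  by rewrite ltnNge leq_addl.
have [w wP] := choice (fun j => span (delta_mx j 0)).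
pose W : 'M[O]_n := \matrix_(i, j) w j i 0.
have colW j : col j W = w j by apply/colP => i; rewrite !mxE.
have bW : b *m u *m W = b.
  apply/matrixP => i j.
  have /colP/(_ i) : col j (b *m u *m W) = col j b.
    by rewrite !colE -mulmxA -[W *m _]colE colW wP.
  by rewrite [LHS]mxE [RHS]mxE.
rewrite unitmxE; apply/unitrP; exists (\det W).
have : \det b * (\det u * \det W) = \det b * 1.
  by rewrite mulr1 mulrA -!det_mulmx bW.
by move/(mulfI (contains_Xn_det_neq0 b_big)) => e; rewrite [_ W * _]mulrC.
Qed.

End Hermite.

(** * Lattices and their triangular types *)

Section Lattices.
Variables (F : fieldType) (n : nat).

Local Notation O := (fps F).
Local Notation K := (laurent F).
Local Notation X := (fpsX F).
Local Notation t := (tK F).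
Local Notation iota := (@FracField.tofrac O).
Local Notation oK := (map_mx iota).
Local Notation gr_coset := (@gr_coset F n).
Local Notation gr_piece := (@gr_piece F n).
Local Notation affGr := (@affGr F n).
Local Notation lattice_of := (@lattice_of F n).

Lemma tK_neq0 : t != 0.
Proof. by rewrite tofrac_eq0 fpsX_neq0. Qed.

Lemma tofrac_inj : injective iota.
Proof. by move=> f g /eqP; rewrite tofrac_eq => /eqP. Qed.

Lemma map_tofrac_inj p q : injective (map_mx iota : 'M_(p, q) -> 'M_(p, q)).
Proof.
move=> A B /matrixP AB; apply/matrixP => i j; apply: tofrac_inj.
by have := AB i j; rewrite !mxE.
Qed.

Lemma tK_expz_neq0 z : t ^ z != 0.
Proof. by rewrite expfz_neq0 // tK_neq0. Qed.

Lemma tofrac_fpsXn d : iota (X ^+ d) = t ^ d%:Z.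
Proof. by rewrite rmorphXn. Qed.

Lemma lattice_of_coset g v :
  lattice_of (gr_coset g) v <-> exists w : 'cV[O]_n, v = g *m oK w.
Proof.
split=> [[_ [a ua <-] [w ->]]|[w ->]].
  by exists (a *m w); rewrite map_mxM mulmxA.
exists g; last by exists w.
by exists 1%:M; [rewrite /= unitmx1 | rewrite map_mx1 mulmx1].
Qed.

Lemma gr_coset_mulr g (u : 'M[O]_n) :
  u \in unitmx -> gr_coset (g *m oK u) = gr_coset g.
Proof.
move=> uu; apply/seteqP; split=> _ [a /= ua <-].
  exists (u *m a); first by rewrite /= unitmx_mul uu.
  by rewrite map_mxM mulmxA.
exists (invmx u *m a); first by rewrite /= unitmx_mul unitmx_inv uu.
by rewrite -mulmxA -map_mxM mulKVmx.
Qed.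

(** Scaling by t^N turns the lattices of the [N]-th piece into the sublattices of O^n containing
    X^(2N) O^n. *)
Definition lattice_mx (N : nat) (b : 'M[O]_n) : 'M[K]_n :=
  t ^ (- N%:Z) *: oK b.

Lemma lattice_mx_col N b w :
  lattice_mx N b *m oK w = t ^ (- N%:Z) *: oK (b *m w) :> 'cV[K]_n.
Proof. by rewrite map_mxM scalemxAl. Qed.

Lemma scale_tK_inj p q z : injective ( *:%R (t ^ z) : 'M[K]_(p, q) -> _).
Proof. by apply: scalerI; exact: tK_expz_neq0. Qed.

Lemma lattice_image_coset (N : nat) (b : 'M[O]_n) :
  @lattice_image F n N (lattice_of (gr_coset (lattice_mx N b))) =
  @jet_image F n (N + N) b.
Proof.
apply/seteqP; split=> y.
  case=> w /= /lattice_of_coset[v]; rewrite lattice_mx_col mxvec_jet.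
  by move=> /scale_tK_inj /map_tofrac_inj -> <-; exists v.
case=> v ->; exists (b *m v); last by rewrite mxvec_jet.
by apply/lattice_of_coset; exists v; rewrite lattice_mx_col.
Qed.

Lemma oK_scaleXn p q d (w : 'M[O]_(p, q)) :
  oK (X ^+ d *: w) = t ^ d%:Z *: oK w.
Proof. by rewrite map_mxZ /= tofrac_fpsXn. Qed.

Lemma contains_Xn_lattice N b :
  contains_Xn (N + N) b <->
  std_lattice N%:Z `<=` lattice_of (gr_coset (lattice_mx N b)).
Proof.
have e (v : 'cV[O]_n) : t ^ N%:Z *: oK v =
    t ^ (- N%:Z) *: oK (X ^+ (N + N) *: v).
  rewrite oK_scaleXn scalerA -expfzDr ?tK_neq0 //; congr (t ^ _ *: _).
  by rewrite PoszD addKr.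
split=> [bb _ [v _ <-]|bb v].
  apply/lattice_of_coset; have [w wE] := bb v.
  by exists w; rewrite lattice_mx_col -wE e.
have /lattice_of_coset[w] :
    lattice_of (gr_coset (lattice_mx N b)) (t ^ N%:Z *: oK v).
  by apply: bb; exists v.
by rewrite e lattice_mx_col => /scale_tK_inj /map_tofrac_inj; exists w.
Qed.

Lemma lattice_mx_unit m N b : contains_Xn m b -> lattice_mx N b \in unitmx.
Proof.
move=> /contains_Xn_det_neq0 db; rewrite unitmxE detZ det_map_mx unitfE.
by rewrite mulf_neq0 ?expf_neq0 ?tK_expz_neq0 ?tofrac_eq0.
Qed.

Lemma lattice_mx_piece N b :
  contains_Xn (N + N) b -> gr_piece N (gr_coset (lattice_mx N b)).
Proof.
move=> bb; split; first by exists (lattice_mx N b) => //; apply: lattice_mx_unit bb.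
split; first exact/contains_Xn_lattice.
move=> _ /lattice_of_coset[w ->]; exists (b *m w) => //.
by rewrite lattice_mx_col.
Qed.

Lemma piece_lattice_mx N g : gr_piece N (gr_coset g) ->
  exists2 b, g = lattice_mx N b & contains_Xn (N + N) b.
Proof.
move=> [_ [Lge Lle]].
have colg j : exists w : 'cV[O]_n, col j g = t ^ (- N%:Z) *: oK w.
  have [|w _ <-] := Lle (col j g); last by exists w.
  by apply/lattice_of_coset; exists (delta_mx j 0); rewrite map_delta_mx colE.
have [w wP] := choice colg.
have gE : g = lattice_mx N (\matrix_(i, j) w j i 0).
  apply/matrixP => i j; have /colP/(_ i) := wP j.
  by rewrite !mxE.
by exists (\matrix_(i, j) w j i 0) => //; apply/contains_Xn_lattice; rewrite -gE.
Qed.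

Variable h : 'I_n -> nat.
Hypothesis h_inj : injective h.

(* [x] lies in the orbit of [t^l] under the group of matrices over [K] that are
   unitriangular for the order of the coordinates given by [h]. *)
Definition has_type (x : set 'M[K]_n) (l : 'rV[int]_n) :=
  exists g, [/\ x = gr_coset g, forall i j, (h i < h j)%N -> g i j = 0
              & forall i, g i i = t ^ (l 0 i)].

Lemma lattice_mx_type N b d : triangular h b d ->
  has_type (gr_coset (lattice_mx N b)) (\row_i ((d i)%:Z - N%:Z)).
Proof.
move=> [b0 bd]; exists (lattice_mx N b); split=> // [i j /b0 bij|i].
  by rewrite !mxE bij tofrac0 mulr0.
by rewrite !mxE bd tofrac_fpsXn -expfzDr ?tK_neq0 // addrC.
Qed.

Lemma piece_type N x : gr_piece N x -> exists l, has_type x l.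
Proof.
move=> xN; have [[g _ gx] _] := xN; subst x.
have [b -> bb] := piece_lattice_mx xN.
have [u [d [uu bu]]] := hermite_form h_inj bb.
exists (\row_i ((d i)%:Z - N%:Z)); rewrite -(gr_coset_mulr _ uu).
rewrite /lattice_mx -scalemxAl -map_mxM.
exact: lattice_mx_type.
Qed.

Lemma tK_expz_tofrac z f : t ^ z = iota f -> exists d, z = d%:Z /\ f = X ^+ d.
Proof.
case: z => [d|d] e.
  by exists d; split=> //; apply: tofrac_inj; rewrite tofrac_fpsXn -e.
have : X ^+ 0 = X ^+ d.+1 * f.
  apply: tofrac_inj; rewrite tofrac_fpsXn rmorphM /= -e rmorphXn /=.
  by rewrite -[t ^ Negz d]/((t ^+ d.+1)^-1) divff // expf_neq0 // tK_neq0.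
by move/leq_fpsXn_dvd.
Qed.

(** The columns of the given triangular representative lie in the lattice, so scaling it by t^N
    makes it integral. Minors can thus be computed for any given type [l], not only for one produced
    by [hermite_form]. *)
Lemma piece_type_lattice_mx N x l : gr_piece N x -> has_type x l ->
  exists b d, [/\ x = gr_coset (lattice_mx N b), contains_Xn (N + N) b,
    triangular h b d & forall i, l 0 i = (d i)%:Z - N%:Z].
Proof.
move=> xN [g [gx g0 gd]]; subst x.
have [b gE bb] := piece_lattice_mx xN; subst g.
have dP i : exists d, l 0 i + N%:Z = d%:Z /\ b i i = X ^+ d.
  apply: tK_expz_tofrac; rewrite expfzDr ?tK_neq0 // -gd !mxE mulrAC.
  by rewrite -expfzDr ?tK_neq0 // addNr mul1r.
have [d dE] := choice dP.
exists b, d; split=> // [|i]; last by rewrite -(dE i).1 addrK.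
split=> [i j ij|i]; last exact: (dE i).2.
have /eqP := g0 i j ij; rewrite !mxE mulf_eq0 (negbTE (tK_expz_neq0 _)) /=.
by rewrite tofrac_eq0 => /eqP.
Qed.

Lemma type_minors N x l k (A : 'M[F]_(k, n * (N + N))) :
    gr_piece N x -> has_type x l ->
    row_basis_of A (@lattice_image F n N (lattice_of x)) ->
  (forall J : 'I_k -> 'I_(n * (N + N)), \det (colsub J A) != 0 -> forall u,
     (count_below h J u)%:Z <= \sum_(i < n | (h i < u)%N) (N%:Z - l 0 i)) /\
  (exists2 J : 'I_k -> 'I_(n * (N + N)), \det (colsub J A) != 0 & forall u,
     (count_below h J u)%:Z = \sum_(i < n | (h i < u)%N) (N%:Z - l 0 i)).
Proof.
move=> xN xl; have [b [d [-> bb bt lE]]] := piece_type_lattice_mx xN xl.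
rewrite lattice_image_coset => /(triangular_minors h_inj bt bb)[Jle [J0 dJ0 J0E]].
have sumE u : \sum_(i < n | (h i < u)%N) (N%:Z - l 0 i) =
    (\sum_(i < n | (h i < u)%N) (N + N - d i))%N%:Z.
  rewrite -[RHS]natz natr_sum; apply: eq_bigr => i _.
  have := triangular_exp_leq h_inj bt bb i.
  by rewrite natz lE; lia.
split; first by move=> J dJ u; rewrite sumE lez_nat Jle.
by exists J0 => // u; rewrite sumE J0E.
Qed.

Lemma type_image_basis N x l : gr_piece N x -> has_type x l ->
  exists k (A : 'M[F]_(k, n * (N + N))),
    row_basis_of A (@lattice_image F n N (lattice_of x)).
Proof.
move=> xN xl; have [b [d [-> bb bt lE]]] := piece_type_lattice_mx xN xl.
exists #|cells (N + N) d|, (cell_mx (N + N) b d).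
by rewrite lattice_image_coset; apply: cell_mx_triangular_basis bt bb.
Qed.

End Lattices.

(** * Closed sets defined by prefix sums *)

Section TypeStrata.
Variables (F : fieldType) (n : nat) (h : 'I_n -> nat).
Hypotheses (h_inj : injective h) (h_lt : forall i, (h i < n)%N).

Local Notation K := (laurent F).
Local Notation has_type := (@has_type F n h).
Implicit Types (x : set 'M[K]_n) (l : 'rV[int]_n).

Definition prefix_sum l (u : nat) : int := \sum_(i < n | (h i < u)%N) l 0 i.

Definition coord_sum l : int := \sum_(i < n) l 0 i.

Lemma prefix_sum_total l : prefix_sum l n = coord_sum l.
Proof. by apply: eq_bigl => i; rewrite h_lt. Qed.

Lemma sum_shift_prefix_sum (N : nat) l u :
  \sum_(i < n | (h i < u)%N) (N%:Z - l 0 i) =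
  \sum_(i < n | (h i < u)%N) N%:Z - prefix_sum l u.
Proof. by rewrite -sumrB. Qed.

Lemma count_below_total m k (J : 'I_k -> 'I_(n * m)) : count_below h J n = k.
Proof.
rewrite /count_below -[RHS]card_ord; apply: eq_card => r.
by rewrite inE h_lt.
Qed.

Lemma type_size N x l k (A : 'M[F]_(k, n * (N + N))) :
    gr_piece N x -> has_type x l ->
    row_basis_of A (@lattice_image F n N (lattice_of x)) ->
  k%:Z = \sum_(i < n | (h i < n)%N) N%:Z - coord_sum l.
Proof.
move=> xN xl xA; have [_ [J _ /(_ n)]] := type_minors h_inj xN xl xA.
by rewrite count_below_total sum_shift_prefix_sum prefix_sum_total.
Qed.

Lemma type_total N x l l' : gr_piece N x ->
  has_type x l -> has_type x l' -> coord_sum l = coord_sum l'.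
Proof.
move=> xN xl xl'; have [k [A xA]] := type_image_basis h_inj xN xl.
have := type_size xN xl' xA; rewrite (type_size xN xl xA).
by move/addrI/oppr_inj.
Qed.

(** The minor that is extremal for [l'] is nonzero, hence obeys the bound for [l]. By symmetry the
    prefix sums depend on [x] alone. *)
Lemma type_prefix_sum_le N x l l' : gr_piece N x ->
  has_type x l -> has_type x l' -> forall u, prefix_sum l u <= prefix_sum l' u.
Proof.
move=> xN xl xl' u; have [k [A xA]] := type_image_basis h_inj xN xl.
have [_ [J dJ Jl']] := type_minors h_inj xN xl' xA.
have [/(_ J dJ u) Jl _] := type_minors h_inj xN xl xA.
move: Jl; rewrite Jl' !sum_shift_prefix_sum; lia.
Qed.

Lemma plucker_ffun k m (A : 'M[F]_(k, m)) (J : 'I_k -> 'I_m) :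
  plucker A (enum_rank [ffun r => J r]) = \det (colsub J A).
Proof.
rewrite /plucker enum_rankK; congr (\det _).
by apply/matrixP => i j; rewrite !mxE ffunE.
Qed.

Definition type_above (tot : int) (low : nat -> int) : set (set 'M[K]_n) :=
  [set x | @affGr F n x /\ exists l,
     [/\ has_type x l, coord_sum l = tot & forall u, low u <= prefix_sum l u]].

(* For [x] in the [N]-th piece, the prefix sums of its type are read off the
   largest number of columns below [u] in a nonzero Pluecker coordinate, so that
   bounding them from below means that certain coordinates vanish. *)
Lemma type_above_closed tot low : gr_closed (type_above tot low).
Proof.
split=> [x []//|N k].
pose bad (J : 'I_#|{ffun 'I_k -> 'I_(n * (N + N))}|) := exists u,
  \sum_(i < n | (h i < u)%N) N%:Z - low u < (count_below h (enum_val J) u)%:Z.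
(* The total determines the dimension [k] of the image; on the other Grassmannians the trace is
   empty and is cut out by the constant 1. *)
pose size_ok := k%:Z == \sum_(i < n | (h i < n)%N) N%:Z - tot.
exists [set p : {mpoly F[#|{ffun 'I_k -> 'I_(n * (N + N))}|]} |
   if size_ok then exists2 J, bad J & p = 'X_J else p = 1].
  move=> p /=; case: ifP => _ => [[J _ ->]|->].
    by exists 1%N; rewrite dhomogX /= mdeg1.
  by exists 0%N; exact: dhomog1.
move=> x A xN xA; split=> [[_ [l [xl ltot lowl]]] p /=|S0].
  rewrite /size_ok (type_size xN xl xA) ltot eqxx => -[J [u Ju] ->].
  rewrite mevalXU; apply/eqP/contraT => dJ.
  have [/(_ _ dJ u)] := type_minors h_inj xN xl xA.
  rewrite sum_shift_prefix_sum => /(lt_le_trans Ju).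
  by rewrite ltrD2l ltrN2 ltNge lowl.
split; first by case: xN.
have [l xl] := piece_type h_inj xN.
have ok : size_ok.
  apply: contraT => /negbTE nok; have := S0 1; rewrite /= nok meval1.
  by move=> /(_ erefl) /eqP; rewrite oner_eq0.
exists l; split=> // [|u].
  by move/eqP: ok; rewrite (type_size xN xl xA) => /addrI/oppr_inj.
have [_ [J dJ JE]] := type_minors h_inj xN xl xA.
rewrite leNgt; apply/negP => lowu; case/eqP: dJ; rewrite -plucker_ffun.
rewrite -mevalXU; apply: S0; rewrite /= ok.
exists (enum_rank [ffun r => J r]) => //.
exists u; have -> : count_below h (enum_val (enum_rank [ffun r => J r])) u =
    count_below h J u.
  by apply: eq_card => r; rewrite !inE enum_rankK ffunE.
by rewrite JE sum_shift_prefix_sum ltrD2l ltrN2.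
Qed.

End TypeStrata.

Section Polynomials.
Variable F : numFieldType.

Lemma poly_nonroot (p : {poly F}) : p != 0 -> exists s, p.[s] != 0.
Proof.
move=> p0; apply: contrapT => np.
have : all (root p) [seq i%:R | i <- iota 0 (size p)].
  apply/allP => _ /mapP[i _ ->]; rewrite /root; apply/negPn/negP => pi.
  by apply: np; exists i%:R.
move/(max_poly_roots p0); rewrite size_map size_iota ltnn.
have nat_inj : injective (fun i : nat => i%:R : F).
  by move=> i j /eqP; rewrite eqr_nat => /eqP.
by rewrite (map_inj_uniq nat_inj) iota_uniq => /(_ isT).
Qed.

(** The extra factor X forces the nonroot found to be nonzero. *)
Lemma poly_eq0_at0 (p : {poly F}) : (forall s, s != 0 -> p.[s] = 0) -> p.[0] = 0.
Proof.
move=> p0; have [->|pn0] := eqVneq p 0; first by rewrite horner0.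
have [|s] := @poly_nonroot (p * 'X); first by rewrite mulf_neq0 ?polyX_eq0.
rewrite hornerM hornerX mulf_eq0 negb_or => /andP[ps s0].
by rewrite p0 ?eqxx in ps.
Qed.

Lemma det_pencil k (A B : 'M[F]_k) :
  exists p : {poly F}, forall s, p.[s] = \det (A + s *: B).
Proof.
exists (\det (map_mx polyC A + 'X *: map_mx polyC B)) => s.
rewrite -[LHS]/(horner_eval s _) -det_map_mx; congr (\det _).
apply/matrixP => i j; rewrite !mxE -[LHS]/(_.[s]) hornerD hornerM hornerX.
by rewrite !hornerC.
Qed.

Lemma colsub_pencil k l N (A B : 'M[F]_(k, N)) (J : 'I_l -> 'I_N) s :
  colsub J A + s *: colsub J B = colsub J (A + s *: B).
Proof. by apply/matrixP => i j; rewrite !mxE. Qed.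

Lemma meval_horner r (p : {mpoly F[r]}) (q : 'I_r -> {poly F}) (s : F) :
  (mmap polyC q p).[s] = p.@[fun i => (q i).[s]].
Proof.
rewrite /mmap /meval /mmap horner_sum; apply: eq_bigr => m _.
rewrite hornerM hornerC; congr (_ * _).
rewrite /mmap1 -[LHS]/(horner_eval s _) rmorph_prod; apply: eq_bigr => i _.
by rewrite rmorphXn.
Qed.

End Polynomials.

(** * Torus-fixed points of affine Schubert varieties *)

Section FixedPoints.
Variables (F : fieldType) (n : nat).

Local Notation O := (fps F).
Local Notation K := (laurent F).
Local Notation X := (fpsX F).
Local Notation t := (tK F).
Local Notation oK := (map_mx (@FracField.tofrac O)).
Local Notation gr_coset := (@gr_coset F n).
Local Notation Lpt := (@Lpt F n).
Local Notation gr_piece := (@gr_piece F n).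

Lemma gr_coset_mull (c g : 'M[K]_n) :
  gr_coset (c *m g) = [set c *m y | y in gr_coset g].
Proof.
apply/seteqP; split=> [_ [a ua <-]|_ [_ [a ua <-] <-]].
  by exists (g *m oK a); [exists a | rewrite mulmxA].
by exists a => //; rewrite mulmxA.
Qed.

Definition shifted_exp (N : nat) (l : 'rV[int]_n) (i : 'I_n) : nat :=
  absz (l 0 i + N%:Z).

Definition bounded_by (N : nat) (l : 'rV[int]_n) :=
  forall i, (absz (l 0%R i) <= N)%N.

Lemma bounded_by_ex l : exists N, bounded_by N l.
Proof.
by exists (\max_i absz (l 0%R i))%N => i; apply: leq_bigmax_cond.
Qed.

Lemma tpow_lattice_mx N l : bounded_by N l ->
  tpow F l = lattice_mx N (diagX F (shifted_exp N l)).
Proof.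
move=> lN; apply/matrixP => i j; rewrite !mxE; case: eqVneq => [->|_].
  rewrite !mulr1n tofrac_fpsXn -expfzDr ?tK_neq0 //; congr (_ ^ _).
  by have := lN j; rewrite /shifted_exp; lia.
by rewrite !mulr0n tofrac0 mulr0.
Qed.

Lemma unit_diagX_contains_Xn N l a : bounded_by N l -> a \in unitmx ->
  contains_Xn (N + N) (a *m diagX F (shifted_exp N l)).
Proof.
move=> lN ua v.
exists (diagX F (fun i => N + N - shifted_exp N l i)%N *m (invmx a *m v)).
rewrite -!mulmxA [diagX _ _ *m _]mulmxA.
have -> : diagX F (shifted_exp N l) *m diagX F (fun i => N + N - shifted_exp N l i)%N
    = (X ^+ (N + N))%:M.
  rewrite mulmx_diag; apply/matrixP => i j; rewrite !mxE -exprD subnKC //.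
  by have := lN i; rewrite /shifted_exp; lia.
by rewrite mul_scalar_mx -scalemxAr mulKVmx.
Qed.

Lemma Lpt_piece N l : bounded_by N l -> gr_piece N (Lpt l).
Proof.
move=> lN; rewrite /Lpt (tpow_lattice_mx lN); apply: lattice_mx_piece.
by rewrite -[diagX _ _]mul1mx; apply: unit_diagX_contains_Xn; rewrite ?unitmx1.
Qed.

Lemma Lpt_type h l : has_type h (Lpt l) l.
Proof.
exists (tpow F l); split=> // [i j ij|i]; last by rewrite !mxE eqxx.
by rewrite !mxE; case: eqVneq ij => // ->; rewrite ltnn.
Qed.

Variable mu : 'rV[int]_n.

Definition cell_point (a : 'M[O]_n) := gr_coset (oK a *m tpow F mu).

Lemma schubert_cellP x :
  schubert_cell mu x <-> exists2 a, iwahori a & x = cell_point a.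
Proof.
split=> [[a ia <-]|[a ia ->]]; exists a => //; first by rewrite -gr_coset_mull.
by rewrite /cell_point gr_coset_mull.
Qed.

Lemma iwahori_unit (a : 'M[O]_n) : iwahori a -> a \in unitmx.
Proof. by case. Qed.

Lemma rhoE (a : 'M[O]_n) : rho a = map_mx (@constant_coef F) a.
Proof. by []. Qed.

Lemma unitmx_rho (a : 'M[O]_n) : (a \in unitmx) = (rho a \in unitmx).
Proof. by rewrite rhoE !unitmxE det_map_mx unitfE. Qed.

Lemma iwahoriE (a : 'M[O]_n) :
  iwahori a <-> rho a \in unitmx /\ is_trig_mx (rho a)^T.
Proof. by split=> [[] //|[ua ta]]; split; rewrite ?unitmx_rho. Qed.

Section Bounded.
Variable N : nat.
Hypothesis muN : bounded_by N mu.

Let dmu := shifted_exp N mu.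

Lemma cell_pointE a : cell_point a = gr_coset (lattice_mx N (a *m diagX F dmu)).
Proof.
by rewrite /cell_point (tpow_lattice_mx muN) /lattice_mx map_mxM scalemxAr.
Qed.

Lemma cell_point_piece a : iwahori a -> gr_piece N (cell_point a).
Proof.
move=> /iwahori_unit ua; rewrite cell_pointE.
exact/lattice_mx_piece/unit_diagX_contains_Xn.
Qed.

(** The row set depends on [mu] alone and the matrix is linear in [a], so minors at different points
    of the cell can be compared. *)
Lemma cell_point_basis a : iwahori a ->
  row_basis_of (cell_mx (N + N) (a *m diagX F dmu) dmu)
    (@lattice_image F n N (lattice_of (cell_point a))).
Proof.
move=> /iwahori_unit ua; rewrite cell_pointE lattice_image_coset.
exact: cell_mx_unit_basis.
Qed.

End Bounded.

Lemma cell_point_total (h : 'I_n -> nat) a a' l l' :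
    injective h -> (forall i, h i < n)%N ->
    iwahori a -> iwahori a' ->
    has_type h (cell_point a) l -> has_type h (cell_point a') l' ->
  coord_sum l = coord_sum l'.
Proof.
move=> h_inj h_lt ia ia' al al'; have [N muN] := bounded_by_ex mu.
have := type_size h_inj h_lt (cell_point_piece muN ia) al (cell_point_basis muN ia).
rewrite (type_size h_inj h_lt (cell_point_piece muN ia') al'
  (cell_point_basis muN ia')).
by move/addrI/oppr_inj.
Qed.

End FixedPoints.

(** * Generic points of the cell and their torus limits *)

Section Degeneration.
Variables (F : numFieldType) (n : nat) (h : 'I_n -> nat) (mu : 'rV[int]_n).
Hypotheses (h_inj : injective h) (h_lt : forall i, (h i < n)%N).

Local Notation O := (fps F).
Local Notation X := (fpsX F).
Local Notation K := (laurent F).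
Local Notation oK := (map_mx (@FracField.tofrac O)).
Local Notation gr_coset := (@gr_coset F n).
Local Notation gr_piece := (@gr_piece F n).
Local Notation Lpt := (@Lpt F n).
Local Notation cell_point := (@cell_point F n mu).
Local Notation has_type := (@has_type F n h).

(** Triangularity of [rho] persists along the line through [a] and [a']; only invertibility can
    fail. *)
Lemma iwahori_pencil (a a' : 'M[O]_n) s :
    iwahori a -> iwahori a' -> \det (rho a + s *: rho (a' - a)) != 0 ->
  iwahori (a + fpsC s *: (a' - a)).
Proof.
move=> /iwahoriE[_ ta] /iwahoriE[_ ta'].
have rE : rho (a + fpsC s *: (a' - a)) = rho a + s *: rho (a' - a).
  by apply/matrixP => i j; rewrite !mxE fcoefD fcoefCM.
move=> dn0; apply/iwahoriE; rewrite rE unitmxE unitfE; split=> //.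
apply/is_trig_mxP => i j ij; rewrite !mxE.
have := is_trig_mxP ta i j ij; have := is_trig_mxP ta' i j ij.
by rewrite !mxE fcoefD fcoefN => -> ->; rewrite subrr mulr0 addr0.
Qed.

(* Both inequalities are open conditions on a general member of the pencil
   spanned by [a] and [a']. *)
Lemma iwahori_common_type a a' l l' :
    iwahori a -> iwahori a' ->
    has_type (cell_point a) l -> has_type (cell_point a') l' ->
  exists a'' l'', [/\ iwahori a'', has_type (cell_point a'') l'' &
    forall u, prefix_sum h l'' u <= prefix_sum h l u /\
              prefix_sum h l'' u <= prefix_sum h l' u].
Proof.
move=> ia ia' al al'; have [N muN] := bounded_by_ex mu.
set d := shifted_exp N mu.
pose C a := cell_mx (N + N) (a *m diagX F d) d.
have CE s : C (a + fpsC s *: (a' - a)) = C a + s *: (C a' - C a).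
  rewrite /C mulmxDl -scalemxAl cell_mx_linear; congr (_ + _ *: _).
  have := cell_mx_linear (N + N) (a *m diagX F d) ((a' - a) *m diagX F d) d 1.
  rewrite rmorph1 !scale1r -mulmxDl [a + _]addrC subrK => ->.
  by rewrite addrAC subrr add0r.
have [_ [J dJ JE]] := type_minors h_inj (cell_point_piece muN ia) al
  (cell_point_basis muN ia).
have [_ [J' dJ' JE']] := type_minors h_inj (cell_point_piece muN ia') al'
  (cell_point_basis muN ia').
(* [p0] and [p1] are nonzero at 0, that is at [a], and [p2] at 1, that is at [a']. At a common
   nonroot the point is in the cell and both extremal minors survive, so they bound the new type. *)
have [p0 p0E] := det_pencil (rho a) (rho (a' - a)).
have [p1 p1E] := det_pencil (colsub J (C a)) (colsub J (C a' - C a)).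
have [p2 p2E] := det_pencil (colsub J' (C a)) (colsub J' (C a' - C a)).
have p0n : p0 != 0.
  apply: contraTneq isT => p00; have := p0E 0.
  rewrite p00 horner0 scale0r addr0 => /esym/eqP.
  have /iwahoriE[] := ia; rewrite unitmxE unitfE => ua _.
  by rewrite (negbTE ua).
have p1n : p1 != 0.
  apply: contraTneq isT => p10; have := p1E 0.
  rewrite p10 horner0 scale0r addr0 => /esym/eqP.
  by rewrite (negbTE dJ).
have p2n : p2 != 0.
  apply: contraTneq isT => p20; have := p2E 1.
  rewrite p20 horner0 colsub_pencil scale1r addrC subrK => /esym/eqP.
  by rewrite (negbTE dJ').
have [s] := poly_nonroot (mulf_neq0 (mulf_neq0 p0n p1n) p2n).
rewrite !hornerM !mulf_eq0 !negb_or p0E p1E p2E => /andP[/andP[s0 s1] s2].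
set a2 := a + fpsC s *: (a' - a); have ia2 : iwahori a2 by apply: iwahori_pencil.
have pa2 := cell_point_piece muN ia2.
have [l2 al2] := piece_type h_inj pa2.
have [J2 _] := type_minors h_inj pa2 al2 (cell_point_basis muN ia2).
exists a2, l2; split=> // u.
rewrite colsub_pencil -CE in s1; rewrite colsub_pencil -CE in s2.
have := J2 _ s1 u; have := J2 _ s2 u.
by rewrite JE JE' !sum_shift_prefix_sum !lerD2l !lerN2.
Qed.

(** Minimise the sum of all prefix sums. Against any competitor, [iwahori_common_type] gives a type
    below both, which by minimality has the same prefix sums as the minimiser. *)
Lemma iwahori_generic_type : exists a l,
  [/\ iwahori a, has_type (cell_point a) l &
   forall a' l', iwahori a' -> has_type (cell_point a') l' ->
     forall u, prefix_sum h l u <= prefix_sum h l' u].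
Proof.
have [N muN] := bounded_by_ex mu.
have type_ge a l i : iwahori a -> has_type (cell_point a) l -> - N%:Z <= l 0 i.
  move=> ia al.
  have [b [d [_ _ _ lE]]] := piece_type_lattice_mx (cell_point_piece muN ia) al.
  by rewrite lE; lia.
(* All types in the cell have entries at least -N; the shift makes the weight nonnegative, so a
   minimum exists. *)
pose wt (l : 'rV[int]_n) : int :=
  \sum_(u < n.+1) \sum_(i < n | (h i < u)%N) (l 0 i + N%:Z).
have wt_ge0 a l : iwahori a -> has_type (cell_point a) l -> 0 <= wt l.
  move=> ia al; apply: sumr_ge0 => u _; apply: sumr_ge0 => i _.
  by have := type_ge a l i ia al; lia.
pose P e := `[< exists a l,
  [/\ iwahori a, has_type (cell_point a) l & wt l = e%:Z] >].
have exP : exists e, P e.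
  have i1 : iwahori (1%:M : 'M[O]_n).
    apply/iwahoriE; rewrite -unitmx_rho unitmx1.
    by rewrite rhoE map_mx1 trmx1 scalar_mx_is_trig.
  have [l al] := piece_type h_inj (cell_point_piece muN i1).
  exists (absz (wt l)); apply/asboolP; exists 1%:M, l.
  by rewrite gez0_abs // (wt_ge0 _ _ i1).
case: (ex_minnP exP) => e /asboolP[a [l [ia al le]]] emin.
exists a, l; split=> // a' l' ia' al'.
have [a2 [l2 [ia2 al2 l2P]]] := iwahori_common_type ia ia' al al'.
have wt_le : wt l <= wt l2.
  rewrite le -[wt l2]gez0_abs ?(wt_ge0 _ _ ia2) // lez_nat; apply: emin.
  by apply/asboolP; exists a2, l2; rewrite gez0_abs // (wt_ge0 _ _ ia2).
have wtB : \sum_(u < n.+1) (prefix_sum h l u - prefix_sum h l2 u) = wt l - wt l2.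
  rewrite -sumrB; apply: eq_bigr => u _; rewrite !big_split /=.
  by rewrite opprD addrACA subrr addr0.
have wt0 : \sum_(u < n.+1) (prefix_sum h l u - prefix_sum h l2 u) = 0.
  apply: le_anti; rewrite {1}wtB subr_le0 wt_le /=; apply: sumr_ge0 => u _.
  by rewrite subr_ge0 (l2P u).1.
have prefix_sum_le (u : 'I_n.+1) : prefix_sum h l u <= prefix_sum h l' u.
  have /eqP : prefix_sum h l u - prefix_sum h l2 u = 0.
    apply: (psumr_eq0P _ wt0) => // v _.
    by rewrite subr_ge0 (l2P v).1.
  by rewrite subr_eq0 => /eqP ->; case: (l2P u).
move=> u; have [un|nu] := ltnP u n.+1; first exact: (prefix_sum_le (Ordinal un)).
have prefix_sumE l0 : prefix_sum h l0 u = prefix_sum h l0 n.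
  by apply: eq_bigl => i; rewrite h_lt (leq_trans (h_lt i)) // ltnW.
by rewrite !prefix_sumE; exact: (prefix_sum_le ord_max).
Qed.

(* Conjugating the triangular representative [g] of the lattice by [s^h] makes
   its off-diagonal entries tend to [0] with [s], while its Pluecker coordinates
   are polynomial in [s]. *)
Lemma degeneration a l : iwahori a -> has_type (cell_point a) l ->
  schubert_variety mu (Lpt l).
Proof.
move=> ia al; have [N muN] := bounded_by_ex mu.
have pa := cell_point_piece muN ia.
have [b [d [aE bb bt lE]]] := piece_type_lattice_mx pa al.
(* Where the subtraction truncates strictly, [b i j] is 0. At s = 0 the diagonal survives because
   0^0 = 1. *)
pose b_ s : 'M[O]_n := \matrix_(i, j) (fpsC (s ^+ (h i - h j)) * b i j).
have bt_ s : triangular h (b_ s) d.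
  split=> [i j ij|i]; rewrite mxE; first by rewrite bt.1 ?mulr0.
  by rewrite subnn expr0 rmorph1 mul1r bt.2.
pose x_ s := gr_coset (lattice_mx N (b_ s)).
(* The constant diagonal matrix [D] belongs to the Iwahori group and [b_ s] is D b D^-1, so [x_ s]
   is the translate by [D] of the original point. *)
have x_cell s : s != 0 -> schubert_cell mu (x_ s).
  move=> s0; pose D : 'M[O]_n := diag_mx (\row_i fpsC (s ^+ h i)).
  have uD : D \in unitmx.
    rewrite unitmxE det_diag; apply: rpred_prod => i _.
    by rewrite mxE rmorph_unit // unitfE expf_neq0.
  have bD : b_ s *m D = D *m b.
    rewrite mul_diag_mx mul_mx_diag; apply/matrixP => i j; rewrite !mxE.
    have [ij|ji] := ltnP (h i) (h j); first by rewrite bt.1 // !mulr0 mul0r.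
    by rewrite mulrAC -rmorphM -exprD subnK.
  apply/schubert_cellP; exists (D *m a).
    have /iwahoriE[ua ta] := ia; apply/iwahoriE.
    rewrite -unitmx_rho unitmx_mul uD unitmx_rho ua; split=> //.
    apply/is_trig_mxP => i j ij; rewrite mul_diag_mx !mxE fcoefCM.
    by have := is_trig_mxP ta i j ij; rewrite !mxE => ->; rewrite mulr0.
  rewrite /x_ -(gr_coset_mulr _ uD) /cell_point map_mxM -mulmxA [RHS]gr_coset_mull.
  rewrite [X in image X _]aE -gr_coset_mull; congr gr_coset.
  by rewrite /lattice_mx -scalemxAl -scalemxAr -!map_mxM bD.
have x0 : x_ 0 = Lpt l.
  rewrite /x_ /Lpt; congr gr_coset; apply/matrixP => i j; rewrite !mxE expr0n.
  have [->|ij] := eqVneq i j; last first.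
    rewrite mulr0n; have [ij'|ji] := ltnP (h i) (h j).
      by rewrite bt.1 // mulr0 tofrac0 mulr0.
    rewrite subn_eq0 leqNgt ltn_neqAle ji andbT eq_sym (inj_eq h_inj) ij /=.
    by rewrite rmorph0 mul0r tofrac0 mulr0.
  rewrite subnn eqxx rmorph1 mul1r bt.2 tofrac_fpsXn mulr1n -expfzDr ?tK_neq0 //.
  by rewrite lE addrC.
have x_piece s : gr_piece N (x_ s).
  have [->|/x_cell/schubert_cellP[a' ia' ->]] := eqVneq s 0; last first.
    exact: cell_point_piece.
  rewrite x0; apply: Lpt_piece => i; have := triangular_exp_leq h_inj bt bb i.
  by rewrite lE; lia.
pose B s := cell_mx (N + N) (b_ s) d.
have Bbasis s : row_basis_of (B s) (@lattice_image F n N (lattice_of (x_ s))).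
  rewrite lattice_image_coset; apply: (cell_mx_triangular_basis h_inj (bt_ s)).
  by apply/contains_Xn_lattice; have [_ []] := x_piece s.
(* A single polynomial matrix specialising to every [B s], including s = 0. *)
pose E : 'M[{poly F}]_(#|cells (N + N) d|, n * (N + N)) :=
  \matrix_(r, c) ((B 1 r c)%:P * 'X^(h (cell_of c).1 - h (cell_of (enum_val r)).1)).
have BE s : B s = map_mx (horner_eval s) E.
  apply/matrixP => r c; rewrite !mxE -[RHS]/(_.[s]) hornerM hornerC hornerXn.
  by rewrite expr1n rmorph1 mul1r mulrCA fcoefCM mulrC.
move=> Z [Zcl cellZ]; have [S _ SP] := Zcl.2 N #|cells (N + N) d|.
rewrite -x0; apply/(SP _ _ (x_piece 0) (Bbasis 0)) => p Sp.
pose q (J : 'I_#|{ffun 'I_#|cells (N + N) d| -> 'I_(n * (N + N))}|) :=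
  \det (colsub (enum_val J) E).
have qE s J : plucker (B s) J = (q J).[s].
  by rewrite -[RHS]/(horner_eval s _) -det_map_mx map_mxsub -BE.
have pE s : p.@[plucker (B s)] = (mmap polyC q p).[s].
  by rewrite meval_horner; apply: meval_eq => J; rewrite qE.
rewrite pE; apply: poly_eq0_at0 => s s0; rewrite -pE.
by apply: (SP _ _ (x_piece s) (Bbasis s)).1 Sp; apply/cellZ/x_cell.
Qed.

(** The generic type is a fixed point by [degeneration]. Its prefix sums bound the whole cell, so
    the closed set [type_above] contains the closure, and a fixed point [Lpt l'] has type [l']. *)
Lemma schubert_fixed_points : exists2 l, schubert_variety mu (Lpt l) &
  forall l', schubert_variety mu (Lpt l') ->
    coord_sum l' = coord_sum l /\ forall u, prefix_sum h l u <= prefix_sum h l' u.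
Proof.
have [a [l [ia al lmin]]] := iwahori_generic_type.
exists l; first exact: degeneration al.
have [N muN] := bounded_by_ex mu.
move=> l' /(_ (type_above h (coord_sum l) (prefix_sum h l))); case.
  split; first exact: type_above_closed.
  move=> _ /schubert_cellP[a' ia' ->].
  have pa' := cell_point_piece muN ia'; split; first by case: pa'.
  have [l2 al2] := piece_type h_inj pa'; exists l2; split=> //; last first.
    by move=> u; exact: (lmin a' l2 ia' al2).
  exact: cell_point_total h_inj h_lt ia' ia al2 al.
move=> _ [l2 [l2t l2l lowl2]]; have [M lM] := bounded_by_ex l'.
have pl := Lpt_piece F lM.
split; first by rewrite -l2l (type_total h_inj h_lt pl (Lpt_type F h l') l2t).
move=> u; apply: le_trans (lowl2 u) _.
exact: (type_prefix_sum_le h_inj pl l2t (Lpt_type F h l')).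
Qed.

End Degeneration.

(** * Edges of the moment polytope *)

Section ConvexGeometry.
Variables (R : realType) (n : nat).
Implicit Types (c d x y u v w e : 'rV[R]_n).

Lemma dotDl c d x : dot (c + d) x = dot c x + dot d x.
Proof. by rewrite -big_split; apply: eq_bigr => i _; rewrite mxE mulrDl. Qed.

Lemma dotZl a c x : dot (a *: c) x = a * dot c x.
Proof. by rewrite mulr_sumr; apply: eq_bigr => i _; rewrite mxE mulrA. Qed.

Lemma dotDr c x y : dot c (x + y) = dot c x + dot c y.
Proof. by rewrite -big_split; apply: eq_bigr => i _; rewrite mxE mulrDr. Qed.

Lemma dotZr a c x : dot c (a *: x) = a * dot c x.
Proof. by rewrite mulr_sumr; apply: eq_bigr => i _; rewrite mxE mulrCA. Qed.

Lemma dotBr c x y : dot c (x - y) = dot c x - dot c y.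
Proof. by rewrite dotDr -scaleN1r dotZr mulN1r. Qed.

Lemma dot0r c : dot c 0 = 0.
Proof. by rewrite -[0](scale0r 0) dotZr mul0r. Qed.

Lemma dot_sumr c k (x : 'I_k -> 'rV[R]_n) :
  dot c (\sum_i x i) = \sum_i dot c (x i).
Proof. exact: (big_morph _ (dotDr c) (dot0r c)). Qed.

Lemma sub_conv_hull (X : set 'rV[R]_n) x : X x -> conv_hull X x.
Proof.
move=> Xx; exists 1%N, (fun=> 1), (fun=> x); split=> //.
  by rewrite big_ord1.
by rewrite big_ord1 scale1r.
Qed.

Lemma conv_hull_dot_le (X : set 'rV[R]_n) c M :
  (forall y, X y -> dot c y <= M) -> forall y, conv_hull X y -> dot c y <= M.
Proof.
move=> XM _ [k [a [p [a0 a1 Xp ->]]]].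
rewrite dot_sumr -[M]mul1r -a1 mulr_suml; apply: ler_sum => i _.
by rewrite dotZr ler_wpM2l ?XM.
Qed.

Lemma conv_hull_pair u v y : conv_hull [set u; v] y ->
  exists a, y = v + a *: (u - v).
Proof.
case=> k [a [p [a0 a1 puv ->]]]; exists (\sum_(i < k | p i == u) a i).
have vE : v = \sum_i a i *: v by rewrite -scaler_suml a1 scale1r.
rewrite [X in _ = X + _]vE scaler_suml [X in _ = _ + X]big_mkcond.
rewrite -big_split /=; apply: eq_bigr => i _; case: eqP => [->|pu].
  by rewrite -scalerDr [v + _]addrC subrK.
by case: (puv i) => // ->; rewrite addr0.
Qed.

Lemma exists_small (s : seq (R * R)) : (forall p, p \in s -> 0 < p.1) ->
  exists2 eps, 0 < eps & forall p, p \in s -> eps * `|p.2| < p.1.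
Proof.
elim: s => [_|[x y] s IH s0]; first by exists 1.
have [|e e0 es] := IH; first by move=> p ps; rewrite s0 // inE ps orbT.
have x0 : 0 < x by apply: (s0 (x, y)); rewrite inE eqxx.
have y0 : 0 < `|y| + 1 by rewrite ltr_wpDl.
exists (Num.min e (x / (`|y| + 1))); first by rewrite lt_min e0 divr_gt0.
move=> p; rewrite inE => /orP[/eqP ->|ps] /=; last first.
  by apply: le_lt_trans (es p ps); rewrite ler_wpM2r // ge_min lexx.
apply: (@le_lt_trans _ _ (x / (`|y| + 1) * `|y|)).
  by rewrite ler_wpM2r // ge_min lexx orbT.
by rewrite mulrAC ltr_pdivrMr // ltr_pM2l // ltrDl.
Qed.

Lemma sorting_perm (f : 'I_n -> R) :
  exists s : 'S_n, forall i j, (s i <= s j)%N -> f i <= f j.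
Proof.
pose leT i j := f i <= f j; pose t := sort leT (enum 'I_n).
have tP i : i \in t by rewrite mem_sort mem_enum.
have tlt i : (index i t < n)%N.
  by rewrite -[X in (_ < X)%N](size_enum_ord n) -(size_sort leT) index_mem tP.
have tI : injective (fun i => Ordinal (tlt i)).
  by move=> i j /(congr1 val) /= /index_inj; apply.
exists (perm tI) => i j; rewrite !permE /=.
apply: (sorted_leq_index (leT := leT)) => //.
- by move=> a b c; apply: le_trans.
- by move=> a; apply: lexx.
- by apply: sort_sorted => a b; apply: le_total.
Qed.

(** Summation by parts: since each proper partial sum of [D] is nonnegative, its coefficient may be
    raised from [g p] to [g p.+1]. *)
Lemma abel_sum_le (g D : nat -> R) p :
    (forall k, (k < p)%N -> g k <= g k.+1) ->
    (forall u : nat, (u <= p)%N -> 0 <= \sum_(k < u) D k) ->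
  \sum_(k < p.+1) g k * D k <= g p * \sum_(k < p.+1) D k.
Proof.
elim: p => [|p IH] gle D0; first by rewrite !big_ord1.
rewrite big_ord_recr /= [in leRHS]big_ord_recr /= mulrDr lerD2r.
apply: le_trans (IH _ _) _ => [k kp|u up|]; first exact/gle/ltnW.
  exact/D0/leqW.
by rewrite ler_wpM2r ?D0 ?gle.
Qed.

Lemma comonotone_sum_le0 (s : 'S_n) c x :
    (forall i j, (s i <= s j)%N -> c 0 i <= c 0 j) ->
    (forall u : nat, 0 <= \sum_(i < n | (s i < u)%N) x 0 i) -> \sum_i x 0 i = 0 ->
  dot c x <= 0.
Proof.
case: n s c x => [|p] s c x cs xs x0; first by rewrite /dot big_ord0.
pose si (k : nat) : 'I_p.+1 := (s^-1)%g (inord k).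
have sumE (G : 'I_p.+1 -> R) (u : nat) : (u <= p.+1)%N ->
    \sum_(i | (s i < u)%N) G i = \sum_(k < u) G (si k).
  move=> up; rewrite (reindex_inj (@perm_inj _ s^-1%g)).
  rewrite (big_ord_widen _ (fun k => G (si k)) up).
  by apply: eq_big => k; rewrite ?permKV // => _; rewrite /si inord_val.
have sumT (G : 'I_p.+1 -> R) : \sum_i G i = \sum_(k < p.+1) G (si k).
  by rewrite -sumE //; apply: eq_bigl => i; rewrite ltn_ord.
rewrite /dot sumT.
apply: le_trans (@abel_sum_le (fun k => c 0 (si k)) (fun k => x 0 (si k)) p _ _) _.
- move=> k kp; apply: cs; rewrite !permKV !inordK //; first exact: ltnW.
- by move=> u up; rewrite -(sumE (fun i => x 0 i)) // ltnW.
- by rewrite -(sumT (fun i => x 0 i)) x0 mulr0.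
Qed.

End ConvexGeometry.

(** An order sorting the double perturbation sorts each single one: distinct values of the
    functional differ by more than 2 eps, and on ties the pairs of nested indicators form a
    chain. *)
Lemma nested_perturbation_le (R : realType) (a b eps : R) (p1 p2 q1 q2 : bool) :
    0 < eps -> (b < a -> eps * 2 < a - b) -> (a < b -> eps * 2 < b - a) ->
    (p1 -> p2) -> (q1 -> q2) ->
    a + eps * p1%:R + eps * p2%:R <= b + eps * q1%:R + eps * q2%:R ->
  a + eps * p1%:R <= b + eps * q1%:R /\ a + eps * p2%:R <= b + eps * q2%:R.
Proof.
move=> eps0 ba ab p12 q12.
have {ba ab} cmp : a = b \/ eps * 2 < a - b \/ eps * 2 < b - a.
  by case: (ltgtP a b) => [/ab|/ba|]; auto.
case: p1 p2 q1 q2 p12 q12 => [] [] [] [] /= p12 q12;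
  try (by have := p12 isT); try (by have := q12 isT);
  by case: cmp => [|[]] *; split; lra.
Qed.

(** * Weight sets with a minimiser for every order of the coordinates *)

Section GreedySets.
Variables (R : realType) (n : nat) (L : set 'rV[int]_n).
Hypothesis n_gt0 : (0 < n)%N.
Hypothesis greedy : forall s : 'S_n, exists2 l, L l &
  forall l', L l' -> coord_sum l' = coord_sum l /\
    forall u, prefix_sum (fun i => s i : nat) l u <=
              prefix_sum (fun i => s i : nat) l' u.

Local Notation real := (map_mx intr : 'rV[int]_n -> 'rV[R]_n).
Local Notation V := [set real l | l in L].

Lemma greedy_finite : exists S : seq 'rV[int]_n, forall l, l \in S <-> L l.
Proof.
have [l0 Ll0 l0P] := greedy 1%g.
have lowP i : exists m : int, forall l, L l -> m <= l 0 i.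
  (* Putting [i] first makes the prefix sum at 1 equal to the i-th coordinate. Upper bounds then
     follow from the constant total. *)
  pose s : 'S_n := tperm i (Ordinal n_gt0).
  have [l1 Ll1 l1P] := greedy s.
  exists (prefix_sum (fun i => s i : nat) l1 1) => l Ll.
  apply: le_trans ((l1P _ Ll).2 1%N) _; rewrite /prefix_sum (bigD1 i) /=; last first.
    by rewrite tpermL.
  rewrite big1 ?addr0 // => j /andP[sj ji]; exfalso.
  have : s j = Ordinal n_gt0 by apply: val_inj; move: sj => /=; case: (s j : nat).
  by rewrite -(tpermL i (Ordinal n_gt0)) => /perm_inj /eqP; rewrite (negbTE ji).
have [m mP] := choice lowP.
pose hi i := coord_sum l0 - \sum_(j < n | j != i) m j.
have hiP l i : L l -> l 0 i <= hi i.
  move=> Ll; rewrite /hi -(l0P _ Ll).1 /coord_sum (bigD1 i) //= lerBrDr.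
  by rewrite lerD2l; apply: ler_sum => j _; apply: mP.
pose M : nat := (\max_i (absz (m i) + absz (hi i)))%N.
have MP (l : 'rV[int]_n) i : L l -> 0 <= l 0 i + M%:Z <= (M + M)%N%:Z.
  move=> Ll; have := mP i _ Ll; have := hiP _ i Ll.
  have : (absz (m i) + absz (hi i) <= M)%N.
    rewrite /M; exact: (leq_bigmax_cond (F := fun i => absz (m i) + absz (hi i))%N i).
  lia.
pose dec (f : 'rV['I_(M + M).+1]_n) : 'rV[int]_n :=
  \row_i ((f 0 i : nat)%:Z - M%:Z).
exists [seq l <- [seq dec f | f : 'rV['I_(M + M).+1]_n] | `[< L l >]] => l.
rewrite mem_filter; split=> [/andP[/asboolP]//|Ll].
apply/andP; split; first exact/asboolP.
apply/mapP; exists (\row_i inord (absz (l 0 i + M%:Z))); first by rewrite mem_enum.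
apply/rowP => i; have /andP[l0i lMi] := MP l i Ll; rewrite !mxE inordK.
  by rewrite gez0_abs // addrK.
by rewrite ltnS -lez_nat gez0_abs.
Qed.

Lemma greedy_polytope : polytope (conv_hull V).
Proof.
have [S SP] := greedy_finite; exists (map real S); congr conv_hull.
apply/seteqP; split=> [_ [l /SP lS <-]|_ /mapP[l /SP Ll ->]]; last by exists l.
exact: map_f.
Qed.

Lemma dot_total l : dot (const_mx 1) (real l) = (coord_sum l)%:~R.
Proof. by rewrite rmorph_sum; apply: eq_bigr => i _; rewrite !mxE mul1r. Qed.

Lemma greedy_dot_max (s : 'S_n) : exists2 l, L l & forall c : 'rV[R]_n,
  (forall i j, (s i <= s j)%N -> c 0 i <= c 0 j) ->
  forall y, conv_hull V y -> dot c y <= dot c (real l).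
Proof.
have [l Ll lP] := greedy s; exists l => // c cs.
apply: conv_hull_dot_le => _ [l' Ll' <-]; rewrite -subr_le0 -dotBr.
have [tot low] := lP _ Ll'; apply: (comonotone_sum_le0 cs) => [u|].
  rewrite (eq_bigr (fun i => (l' 0 i - l 0 i)%:~R)); last first.
    by move=> i _; rewrite !mxE rmorphB.
  rewrite -(rmorph_sum (intr : int -> R)) ler0z /= sumrB subr_ge0; exact: low.
transitivity (dot (const_mx 1) (real l' - real l)).
  by apply: eq_bigr => i _; rewrite !mxE mul1r.
by rewrite dotBr !dot_total tot subrr.
Qed.

(** The constant functionals 1 and -1 are both monotone along any order, hence maximised at the same
    point. *)
Lemma conv_dot1 x y : conv_hull V x -> conv_hull V y ->
  dot (const_mx 1) x = dot (const_mx 1) y.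
Proof.
have [l Ll lP] := greedy_dot_max 1%g.
suff H z : conv_hull V z -> dot (const_mx 1) z = dot (const_mx 1) (real l).
  by move=> /H -> /H ->.
move=> Vz; apply: le_anti; rewrite lP //=; last by move=> i j _; rewrite !mxE.
rewrite -lerN2; have dN w : - dot (const_mx 1 : 'rV[R]_n) w = dot (const_mx (-1)) w.
  by rewrite /dot -sumrN; apply: eq_bigr => i _; rewrite !mxE mul1r mulN1r.
by rewrite !dN lP // => i j _; rewrite !mxE.
Qed.

(* If [d = u - v] had two positive coordinates [i] and [i'], the nested sets
   [E1 = {i}] and [E2 = {i} + {k | d_k < 0}] would satisfy [d(E1) > 0 > d(E2)].
   Small perturbations of [c] along [1_E1] and [1_E2] select [u] and [v]
   respectively, yet as nested indicators are comonotone both are maximised at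
   the vertex attached to one common order of the coordinates. *)
Lemma edge_one_positive (c u v : 'rV[R]_n) i i' :
    conv_hull V u -> conv_hull V v -> dot c u = dot c v ->
    (forall y, conv_hull V y -> dot c y <= dot c u) ->
    (forall y, conv_hull V y -> dot c y = dot c u ->
       exists a, y = v + a *: (u - v)) ->
    0 < (u - v) 0 i -> 0 < (u - v) 0 i' ->
  i = i'.
Proof.
move=> Vu Vv cuv cmax cface; set d := u - v => di di'.
apply/eqP/contraT => ii'.
pose b1 k := k == i; pose b2 k := (k == i) || (d 0 k < 0).
pose e1 : 'rV[R]_n := \row_k (b1 k)%:R; pose e2 : 'rV[R]_n := \row_k (b2 k)%:R.
have e1d : 0 < dot e1 d.
  rewrite /dot (bigD1 i) //= mxE /b1 eqxx mul1r big1 ?addr0 // => k /negbTE ki.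
  by rewrite mxE /b1 ki mul0r.
have e2d : dot e2 d < 0.
  have : dot (const_mx 1) d = 0 by rewrite dotBr (conv_dot1 Vu Vv) subrr.
  (* The coordinates of [d] sum to 0, and off [b2] they are nonnegative with a positive one at
     [i']. *)
  have -> : const_mx 1 = e2 + \row_k (~~ b2 k)%:R.
    by apply/rowP => k; rewrite !mxE; case: (b2 k); rewrite ?addr0 ?add0r.
  rewrite dotDl => e; suff : 0 < dot (\row_k (~~ b2 k)%:R) d by lra.
  have i'b : ~~ b2 i' by rewrite /b2 eq_sym (negbTE ii') /= -leNgt ltW.
  rewrite /dot (bigD1 i') //= mxE i'b mul1r ltr_pwDl // sumr_ge0 // => k _.
  rewrite mxE /b2; case: eqP => [->|_] /=; first by rewrite mul0r.
  by case: ltP => k0; rewrite ?mul0r ?mul1r.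
have [S SP] := greedy_finite.
(* The first pairs keep strict inequalities between coordinates of [c] under both perturbations. The
   second keep a point of [L] off the face from beating [u] after perturbing along [e1]. *)
pose gaps := [seq (p, 2) | p <- [seq c 0 j - c 0 k | j <- enum 'I_n, k <- enum 'I_n]
                & 0 < p] ++
  [seq p <- [seq (dot c u - dot c (real l), dot e1 (real l) - dot e1 u) | l <- S]
    | 0 < p.1].
have [|eps eps0 epsP] := @exists_small R gaps.
  move=> p; rewrite mem_cat => /orP[/mapP[q]|].
    by rewrite mem_filter => /andP[q0 _] ->.
  by rewrite mem_filter => /andP[].
have eps_c j k : c 0 k < c 0 j -> eps * 2 < c 0 j - c 0 k.
  move=> jk; have /= := epsP (c 0 j - c 0 k, 2); rewrite normr_nat; apply.
  rewrite mem_cat; apply/orP; left; apply: map_f; rewrite mem_filter subr_gt0 jk.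
  by apply: allpairs_f; rewrite mem_enum.
have eps_l l : L l -> dot c (real l) < dot c u ->
    eps * (dot e1 (real l) - dot e1 u) < dot c u - dot c (real l).
  move=> /SP lS lu.
  have /epsP /= : (dot c u - dot c (real l), dot e1 (real l) - dot e1 u) \in gaps.
    rewrite mem_cat mem_filter /= subr_gt0 lu /=; apply/orP; right.
    exact: (map_f (fun l =>
      (dot c u - dot c (real l), dot e1 (real l) - dot e1 u))).
  by apply: le_lt_trans; rewrite ler_pM2l // ler_norm.
have [s sP] := sorting_perm (fun k => c 0 k + eps * (b1 k)%:R + eps * (b2 k)%:R).
have [l Ll lP] := greedy_dot_max s; set w := real l in lP.
have Vw : conv_hull V w by apply: sub_conv_hull; exists l.
have b12 k : b1 k -> b2 k by rewrite /b2 -/(b1 k) => ->.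
have split_le j k : (s j <= s k)%N ->
    c 0 j + eps * (b1 j)%:R <= c 0 k + eps * (b1 k)%:R /\
    c 0 j + eps * (b2 j)%:R <= c 0 k + eps * (b2 k)%:R.
  by move=> /sP; apply: nested_perturbation_le => //; first [exact: eps_c | exact: b12].
have c1P y : conv_hull V y -> dot (c + eps *: e1) y <= dot (c + eps *: e1) w.
  by apply: lP => j k /split_le[]; rewrite !mxE.
have c2P y : conv_hull V y -> dot (c + eps *: e2) y <= dot (c + eps *: e2) w.
  by apply: lP => j k /split_le[]; rewrite !mxE.
have cw : dot c w = dot c u.
  apply: le_anti; rewrite cmax //= leNgt; apply/negP => wu.
  have := eps_l l Ll wu; have := c1P u Vu; rewrite !dotDl !dotZl -/w mulrBr; lra.
have [a wE] := cface w Vw cw.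
(* With w = v + a d, comparison with [v] along [e2] gives a <= 0, and with [u] along [e1] gives a >=
   1. *)
have := c1P u Vu; have := c2P v Vv.
rewrite !dotDl !dotZl cw cuv !lerD2l !ler_pM2l // -subr_ge0 -dotBr.
rewrite wE [v + _ - v]addrC addKr dotZr -/d => h2 h1.
have a0 : a <= 0.
  by rewrite leNgt; apply/negP => a0; move: h2; rewrite pmulr_rge0 // leNgt e2d.
have : 0 <= dot e1 (w - u) by rewrite dotBr subr_ge0 wE.
have -> : w - u = (a - 1) *: d.
  by rewrite wE /d scalerBl scale1r opprB addrAC addrC.
rewrite dotZr pmulr_lge0 // => a1; lra.
Qed.

Lemma greedy_edges u v : adjacent (conv_hull V) u v ->
  exists (i j : 'I_n) (c : R), u - v = c *: (delta_mx 0 i - delta_mx 0 j).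
Proof.
case=> _ _ uv [c faceE].
have inF y : conv_hull [set u; v] y ->
    conv_hull V y /\ forall z, conv_hull V z -> dot c z <= dot c y.
  by rewrite faceE.
have [Vu umax] : conv_hull V u /\ forall z, conv_hull V z -> dot c z <= dot c u.
  by apply/inF/sub_conv_hull; left.
have [Vv vmax] : conv_hull V v /\ forall z, conv_hull V z -> dot c z <= dot c v.
  by apply/inF/sub_conv_hull; right.
have cuv : dot c u = dot c v by apply: le_anti; rewrite umax ?vmax.
have face y : conv_hull V y -> dot c y = dot c u -> conv_hull [set u; v] y.
  by move=> Vy cy; rewrite faceE; split=> // z; rewrite cy; apply: umax.
have onepos := @edge_one_positive c u v _ _ Vu Vv cuv umax
  (fun y Vy cy => conv_hull_pair (face y Vy cy)).
(* Exchanging [u] and [v] turns negative coordinates into positive ones. As the sum is 0, exactly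
   one coordinate of each sign remains. *)
have oneneg i i' : 0 < (v - u) 0 i -> 0 < (v - u) 0 i' -> i = i'.
  apply: (@edge_one_positive c v u _ _ Vv Vu (esym cuv) vmax).
  by move=> y Vy cy; apply: conv_hull_pair; rewrite setUC; apply: face; rewrite ?cuv.
set d := u - v in onepos *.
have dN k : (v - u) 0 k = - d 0 k by rewrite -opprB mxE.
have d0 : \sum_k d 0 k = 0.
  transitivity (dot (const_mx 1) d); last by rewrite dotBr (conv_dot1 Vu Vv) subrr.
  by apply: eq_bigr => k _; rewrite [const_mx _ _ _]mxE mul1r.
have dn0 : d != 0 by rewrite subr_eq0.
clearbody d; have [i di] : exists i, 0 < d 0 i.
  apply: contrapT => ni; move/eqP: dn0; apply.
  have dle k : 0 <= - d 0 k.
    by rewrite oppr_ge0 leNgt; apply/negP => dk; apply: ni; exists k.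
  have dN0 : \sum_k - d 0 k = 0 by rewrite sumrN d0 oppr0.
  apply/rowP => k; rewrite mxE; apply: oppr_inj; rewrite oppr0.
  exact: (psumr_eq0P (fun k _ => dle k) dN0).
have [j dj] : exists j, d 0 j < 0.
  apply: contrapT => nj; have dge k : 0 <= d 0 k.
    by rewrite leNgt; apply/negP => dk; apply: nj; exists k.
  have di0 : d 0 i = 0 by apply: (psumr_eq0P _ d0).
  by rewrite di0 ltxx in di.
exists i, j, (d 0 i).
have ij : i != j by apply: contraTneq di => ->; rewrite -leNgt ltW.
have dk k : k != i -> k != j -> d 0 k = 0.
  move=> ki kj; case: (ltgtP (d 0 k) 0) => // hk.
    by case/eqP: kj; apply: oneneg; rewrite dN oppr_gt0.
  by case/eqP: ki; apply: onepos.
have dij : d 0 j = - d 0 i.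
  move: d0; rewrite (bigD1 i) //= (bigD1 j) 1?eq_sym //= big1 ?addr0 => [|k].
    by move/eqP; rewrite addrC addr_eq0 => /eqP.
  by case/andP=> ki kj; apply: dk.
apply/rowP => k; rewrite !mxE /=.
have [->|ki] := eqVneq k i; first by rewrite (negbTE ij) subr0 mulr1.
have [->|kj] := eqVneq k j; first by rewrite sub0r mulrN1.
by rewrite subrr mulr0 dk.
Qed.

End GreedySets.

Theorem corollary1p3 (R : realType) (n : nat) (hn : (0 < n)%N)
    (mu : 'rV[int]_n) :
  generalized_permutahedron (moment_polytope (@schubert_variety R[i] n mu)).
Proof.
have greedy (s : 'S_n) := @schubert_fixed_points R[i] n (fun i => s i : nat) mu
  (fun i j e => perm_inj (val_inj e)) (fun i => ltn_ord (s i)).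
split; first exact: (greedy_polytope R hn greedy).
by move=> u v; apply: greedy_edges hn greedy u v.
Qed.
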